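(* Let $1\le q\le\infty$, let $(\mu_n)\in\mathcal{F}_q$, and suppose that the validation sets $V_n$ satisfy: as $n\to\infty$, for all $v\in V_n$, $|v|\asymp c_n$ for some sequence $c_n$. Define $b_n=\min\{n-c_n,c_n\}$. Let $m_n$ be any sequence which tends to infinity with $m_n=o(b_n^{1/4})$, let $$a_n=\frac{n(\log p)^{1/4+1/(2q)}m_n}{b_n^{1/4}},\qquad t_n=o\left(\frac{b_n^{1/4}}{m_n(\log p)^{1/4+1/(2q)}}\right),$$ let $t_{\max}=\|Y\|_2^2/a_n$, and let $\hat t$ be the minimizer of the cross-validation risk over $T=[0,t_{\max}]$. Then for every $\delta>0$, for $n$ large enough and $p=o\left(\exp\{b_n^{q/(q+2)}\}\right)$, $$\mathbb{P}_{\mu_n}\left(\mathcal{E}(\hat t,t_n)>\delta\right)\le\frac{1}{m_n^2\delta}\left(1+\sqrt{\frac{b_n}{n}}\right)+2\exp\left(-\frac{n}{8e^2}\right).$$ In particular, $\mathbb{P}_{\mu_n}(\mathcal{E}(\hat t,t_n)>\delta)\to0$.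
   Context: For each $n$, let $p=p_n$ (allowed to grow with $n$), and let $Z_i^\top=(Y_i,X_i^\top)$, $i=1,\ldots,n$, be i.i.d. from a distribution $\mu_n$, with $Y_i\in\mathbb{R}$ and $X_i\in\mathbb{R}^p$. Let $\mathcal{Z}^\top=(\mathcal{Y},\mathcal{X}^\top)\sim\mu_n$ be a new independent draw, with zero-based indexing $\mathcal{Z}_0=\mathcal{Y}$. The model is $\mathcal{Y}=f^*(\mathcal{X})+\epsilon$ with $\epsilon$ and $\mathcal{X}$ independent and $f^*$ an unknown (not necessarily linear) function. Write $Y=(Y_1,\ldots,Y_n)^\top$ and $\mathbb{X}=[X_1,\ldots,X_n]^\top\in\mathbb{R}^{n\times p}$. Distribution class: for a nondecreasing convex $\psi$ with $\psi(0)=0$, $\|\xi\|_\psi=\inf\{c>0:\mathbb{E}\,\psi(|\xi|/c)\le1\}$, and $\|\cdot\|_{\psi_q}$ denotes this norm for $\psi_q(x)=\exp(x^q)-1$. For $1\le q<\infty$ and a constant $C_q$ independent of $n$, $\mathcal{F}_q$ is the set of sequences $(\mu_n)$ of distributions such that, for $\xi\sim\mu_n$, $\max_{0\le j,k\le p}\|\xi_j\xi_k-\mathbb{E}_{\mu_n}\xi_j\xi_k\|_{\psi_q}\le C_q$. $\mathcal{F}_\infty$ is the analogous set of $(\mu_n)$ with $|\xi_j|\le C_\infty$ almost surely for each $j$. Convention when $q=\infty$: $c/\infty=0$ for $0<c<\infty$ and $\infty/\infty=1$ (so $q/(q+2)=1$). Risk: $R(\beta)=\mathbb{E}_{\mu_n}[(\mathcal{Y}-\mathcal{X}^\top\beta)^2]$;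 for an estimator $\hat\beta$, $R(\hat\beta)=\mathbb{E}_{\mu_n}[(\mathcal{Y}-\mathcal{X}^\top\hat\beta)^2\mid Z_1,\ldots,Z_n]$. Lasso: with $\mathcal{B}_t=\{\beta\in\mathbb{R}^p:\|\beta\|_1\le t\}$, $\hat\beta_t\in\operatorname{argmin}_{\beta\in\mathcal{B}_t}\frac1n\|Y-\mathbb{X}\beta\|_2^2$. Oracle: $\beta_t=\operatorname{argmin}_{\beta\in\mathcal{B}_t}R(\beta)$. Excess risk: $\mathcal{E}(\hat t,t)=R(\hat\beta_{\hat t})-R(\beta_t)$. Cross-validation: $V_n=\{v_1,\ldots,v_K\}$ is a set of validation sets $v\subset\{1,\ldots,n\}$, $\hat\beta^{(v)}_t$ is the lasso estimator $\hat\beta_t$ computed with the observations in $v$ removed, and $\hat R_{V_n}(t)=\frac1K\sum_{v\in V_n}\frac1{|v|}\sum_{r\in v}(Y_r-X_r^\top\hat\beta^{(v)}_t)^2$. The selected parameter is $\hat t=\operatorname{argmin}_{t\in T}\hat R_{V_n}(t)$.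
   Formalization: Two assumptions are added, without which the claim fails: the training sizes satisfy n−|v| ≍ n−c_n uniformly over v in V_n (besides |v| ≍ c_n), and the second moments E Y² under μ_n are bounded in n; also t_n ≥ 0 and the excess risk is assumed measurable. *)

(* Defs.v *)
From HB Require Import structures.
From mathcomp Require Import all_boot all_order all_algebra.
From mathcomp Require Import all_classical all_reals all_analysis.
From mathcomp Require Import measurable_realfun.

Set Implicit Arguments.
Unset Strict Implicit.
Unset Printing Implicit Defensive.

Import Order.TTheory GRing.Theory Num.Theory.
Import numFieldNormedType.Exports.

Local Open Scope classical_set_scope.
Local Open Scope ring_scope.

Definition is_argmin {T : Type} {d : Order.disp_t} {U : porderType d}
    (f : T -> U) (A : set T) (x : T) : Prop :=
  A x /\ forall y, A y -> (f x <= f y)%O.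

(** One observation is z = (y, x_1, ..., x_p): component 0 is the response. *)
Notation obs R p := ((p.+1).-tuple R).

Section data.
Context {R : realType} {p : nat}.

Definition response (z : obs R p) : R := thead z.

Definition covariates (z : obs R p) : p.-tuple R := [tuple of behead z].

Definition sq_loss (z : obs R p) (beta : 'rV[R]_p) : R :=
  (response z - \sum_(j < p) tnth (covariates z) j * beta 0 j) ^+ 2.

Definition l1_ball (t : R) : set 'rV[R]_p :=
  [set beta | \sum_(j < p) `|beta 0 j| <= t].

(** The risk of a data-dependent [beta], conditionally on the data, is the
    value of [risk mu] at the realised [beta], since the new draw has law [mu]
    and is independent of the data. *)
Definition risk (mu : probability (obs R p) R) (beta : 'rV[R]_p) : \bar R :=
  'E_mu[fun z => sq_loss z beta].

Definition regression_model (mu : probability (obs R p) R) : Prop :=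
  exists2 f : p.-tuple R -> R, measurable_fun setT f &
    forall (A : set R) (B : set (p.-tuple R)), measurable A -> measurable B ->
      let epsA := [set z | A (response z - f (covariates z))] in
      let covB := [set z | B (covariates z)] in
      mu (epsA `&` covB) = (mu epsA * mu covB)%E.

Definition iid_sample {n : nat} {d : measure_display} {Omega : measurableType d}
    (P : probability Omega R) (mu : probability (obs R p) R)
    (Z : 'I_n -> {RV P >-> obs R p}) : Prop :=
  (forall i (B : set (obs R p)), measurable B -> distribution P (Z i) B = mu B)
  /\ (forall (J : {set 'I_n}) (B : 'I_n -> set (obs R p)),
        (forall i, measurable (B i)) ->
        P (\bigcap_(i in [set` J]) (Z i @^-1` B i)) =
        (\prod_(i in J) P (Z i @^-1` B i))%E).

Definition empirical_risk {n : nat} (S : {set 'I_n}) (z : 'I_n -> obs R p)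
    (beta : 'rV[R]_p) : R :=
  #|S|%:R^-1 * \sum_(i in S) sq_loss (z i) beta.

(** [bhat S t] is the estimator with radius [t] fitted on the observations
    indexed by [S]. *)
Definition cv_risk {n : nat} (V : {set {set 'I_n}}) (z : 'I_n -> obs R p)
    (bhat : {set 'I_n} -> R -> 'rV[R]_p) (t : R) : R :=
  #|V|%:R^-1 * \sum_(v in V) empirical_risk v z (bhat (~: v) t).

End data.

(** Equal to +oo when no scale [c] is admissible. *)
Definition orlicz_norm {d : measure_display} {T : measurableType d}
    {R : realType} (mu : probability T R) (psi : R -> R) (xi : T -> R) : \bar R :=
  ereal_inf [set c%:E | c in
    [set c : R | 0 < c /\ ('E_mu[fun z => psi (`|xi z| / c)%R] <= 1)%E]].

Definition psi_exp {R : realType} (q : R) (x : R) : R := expR (x `^ q) - 1.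

(** The class of sequences of laws with exponent [q] and constant [C]; only
    1 <= q <= +oo is used. *)
Definition dist_class {R : realType} (q : \bar R) (C : R) (p : nat -> nat)
    (mu : forall n, probability (obs R (p n)) R) : Prop :=
  match q with
  | q'%:E => forall n (j k : 'I_(p n).+1),
      let xi := fun z : obs R (p n) => tnth z j * tnth z k in
      (mu n).-integrable setT (EFin \o xi) /\
      (orlicz_norm (mu n) (psi_exp q')
         (fun z => xi z - fine 'E_(mu n)[xi])%R <= C%:E)%E
  | +oo%E => forall n (j : 'I_(p n).+1),
      {ae mu n, forall z, `|tnth z j| <= C}
  | -oo%E => False
  end.

(** 1/4 + 1/(2q), with 1/oo = 0. *)
Definition log_exponent {R : realType} (q : \bar R) : R :=
  if q is q'%:E then 4^-1 + (2 * q')^-1 else 4^-1.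

(** q/(q+2), equal to 1 for q = oo. *)
Definition dim_exponent {R : realType} (q : \bar R) : R :=
  if q is q'%:E then q' / (q' + 2) else 1.

(** [f n v] is of exact order [c n] as n -> oo, uniformly over v in [V n]. *)
Definition uniform_asymp {R : realType} (V : forall n, {set {set 'I_n}})
    (f : forall n, {set 'I_n} -> R) (c : nat -> R) : Prop :=
  exists k : R * R, [/\ 0 < k.1, 0 < k.2 &
    \forall n \near \oo, forall v, v \in V n ->
      k.1 * c n <= f n v /\ f n v <= k.2 * c n].

Definition excess_risk {R : realType} {p : nat} (mu : probability (obs R p) R)
    (bhat bstar : R -> 'rV[R]_p) (that t : R) : \bar R :=
  (risk mu (bhat that) - risk mu (bstar t))%E.

(* Main.v *)
Require Import Defs.
From HB Require Import structures.
From mathcomp Require Import all_boot all_order all_algebra.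
From mathcomp Require Import all_classical all_reals all_analysis.
From mathcomp Require Import measurable_realfun.
From mathcomp Require Import ring lra.

(** Write [gamma = (1, - beta)]. The loss of [beta] at [z] is the square of the
    linear form [sum_j gamma_j z_j], so both the risk and an empirical risk are
    quadratic forms in [gamma], one with the second moments [E z_j z_k] as
    matrix, the other with the empirical second moments. On the l1 ball of
    radius [t] they therefore differ by at most
    [|D_00| + (2 t + t^2) max_jk |D_jk|], where [D] is the matrix of deviations
    of the empirical second moments. Comparing the empirical and the true risk
    on the full sample, on the validation sets and on their complements bounds
    the excess risk by averages over [V] of such errors, provided that
    [t_n <= tmax] ([cv_excess_risk_le]).

    If [t_n <= tmax] fails, then [||Y||^2 / n] is small, because [t_n] is of
    smaller order than [b^(1/4) / (m L)] while [tmax] is [||Y||^2 / n] times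
    that quantity. The null vector then has small risk already, and the lasso
    fit is nearly as good ([excess_risk_good]).

    It remains to control the deviations. Expectation bounds and Markov's
    inequality would give a multiple of [1 / (m^2 delta)], and the constant
    would be lost. Exponential tails remove it: the deviation probabilities are
    of order [exp (- c m)], which is eventually below [1 / (m^2 delta)]. All the
    distribution classes give a bound on [E exp (kappa |xi - E xi|)] for
    [xi = z_j z_k], uniform in [n], [j] and [k] ([dist_class_mgf]), hence a
    sub-Gaussian moment generating function near 0 ([mgf_subgaussian]). By
    independence ([integral_prod_indep]) the deviations satisfy a Bernstein
    bound. There may be exponentially many validation sets, which rules out a
    union bound over [V]; the average over [V] is handled inside the
    exponential instead ([averaged_tail]).

    The rates enter in [excess_risk_rate] through [r = b^(1/4)] and
    [y = (ln p)^(1/4)]. The hypothesis on [p] gives [y <= r], and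
    [L >= y / 2] gives [tmax <= C r / (y m)] with high probability. With
    Chernoff parameter [s] proportional to [r^2 y^2], the variance term
    [s^2 / b] and the entropy term [ln ((p + 1)^2)] are both [O (ln p)], whereas
    [s] times the threshold for the maximal deviation is at least [c m ln p].
    The entry [D_00] carries no factor [t]; it is treated alone with [s]
    proportional to [r^2], which costs no factor [p]. When [p <= 1] the factor
    [L] vanishes, both radii are 0 and so is the excess risk. *)

Set Implicit Arguments.
Unset Strict Implicit.
Unset Printing Implicit Defensive.

Import Order.TTheory GRing.Theory Num.Theory.
Import numFieldNormedType.Exports.
Import HBNNSimple.

Local Open Scope classical_set_scope.
Local Open Scope ring_scope.

(** * Independence and expectations of products *)

Local Open Scope ereal_scope.

(** Linearity carries the hypothesis from indicators to simple functions, and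
    monotone convergence from those to nonnegative measurable functions. *)
Lemma integral_mul_indep d d' (Om : measurableType d) (T : measurableType d')
    (R : realType) (P : probability Om R) (X : Om -> T) (W : Om -> R)
    (c : R) (h : T -> R) :
  measurable_fun setT X -> measurable_fun setT W -> (forall w, 0 <= W w)%R ->
  (0 <= c)%R ->
  (forall B, measurable B ->
     \int[P]_w ((\1_B (X w) : R) * W w)%:E =
     c%:E * \int[P]_w (\1_B (X w) : R)%:E) ->
  measurable_fun setT h -> (forall z, 0 <= h z)%R ->
  \int[P]_w (h (X w) * W w)%:E = c%:E * \int[P]_w (h (X w))%:E.
Proof.
move=> mX mW W0 c0 hB mh h0.
have mEh : measurable_fun setT (EFin \o h) by apply/measurable_EFinP.
pose f_ := nnsfun_approx (@measurableT _ T) mEh.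
have mEW : measurable_fun setT (fun w => (W w)%:E) by apply/measurable_EFinP.
have mf n : measurable_fun setT (fun w => (f_ n (X w))%:E).
  by apply/measurable_EFinP; apply: measurableT_comp.
have mI B : measurable B -> measurable_fun setT (fun w => (\1_B (X w) : R)%:E).
  move=> mB; apply/measurable_EFinP.
  exact: (measurableT_comp (measurable_indic mB) mX).
have cvf w : (f_ n (X w))%:E @[n --> \oo] --> (h (X w))%:E.
  by apply: cvg_nnsfun_approx => // z _; rewrite lee_fin.
have ndf w : {homo (fun n => (f_ n (X w))%:E) : a b / (a <= b)%N >-> a <= b}.
  by move=> a b ab; rewrite lee_fin; exact/lefP/nd_nnsfun_approx.
have step n : \int[P]_w (f_ n (X w) * W w)%:E = c%:E * \int[P]_w (f_ n (X
    w))%:E.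
  have fE z : (f_ n z)%:E =
      \sum_(k \in range (f_ n)) (k%:E * (\1_(f_ n @^-1` [set k]) z : R)%:E).
    by rewrite fimfunE -fsumEFin//; apply: eq_fsbigr => k _; rewrite EFinM.
  have pos k z : 0 <= k%:E * (\1_(f_ n @^-1` [set k]) z : R)%:E.
    exact: nnfun_muleindic_ge0.
  have mS k : measurable (f_ n @^-1` [set k]) by exact: measurable_funPTI.
  transitivity (\sum_(k \in range (f_ n))
     \int[P]_w (k%:E * (\1_(f_ n @^-1` [set k]) (X w) : R)%:E * (W w)%:E)).
    rewrite -ge0_integral_fsum//; last 2 first.
    - move=> k; apply: emeasurable_funM => //.
      by apply: emeasurable_funM => //; exact: mI.
    - by move=> k w _; rewrite mule_ge0// lee_fin.
    by apply: eq_integral => w _; rewrite EFinM fE ge0_mule_fsuml.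
  transitivity (\sum_(k \in range (f_ n))
     c%:E * \int[P]_w (k%:E * (\1_(f_ n @^-1` [set k]) (X w) : R)%:E)).
    apply: eq_fsbigr => k /[!inE] -[z _ <-].
    have fz0 : 0 <= (f_ n z)%:E by rewrite lee_fin.
    rewrite [in RHS]ge0_integralZl//; last exact: mI.
    rewrite muleCA -hB// -ge0_integralZl//.
    - by apply: eq_integral => w _; rewrite -muleA -EFinM.
    - apply/measurable_EFinP; apply: measurable_funM => //.
      by apply/measurable_EFinP; exact: mI.
    - by move=> w _; rewrite lee_fin mulr_ge0.
  rewrite -ge0_mule_fsumr; last first.
    by move=> k; apply: integral_ge0.
  congr (_ * _); rewrite -ge0_integral_fsum//.
  - by apply: eq_integral => w _; rewrite fE.
  - by move=> k; apply: emeasurable_funM => //; exact: mI.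
have L1 : \int[P]_w (f_ n (X w) * W w)%:E @[n --> \oo] -->
          \int[P]_w (h (X w) * W w)%:E.
  under [X in _ --> X]eq_integral => w _.
    have -> : (h (X w) * W w)%:E = limn (fun n => (f_ n (X w) * W w)%:E).
      apply/esym/cvg_lim => //; under eq_fun do rewrite EFinM.
      by rewrite EFinM; exact: cvgeZr.
    over.
  apply: cvg_monotone_convergence => //.
  - move=> n; apply/measurable_EFinP; apply: measurable_funM => //.
    by apply: measurableT_comp mX.
  - by move=> n w _; rewrite lee_fin mulr_ge0.
  - move=> w _ a b ab; rewrite lee_fin ler_wpM2r// -lee_fin; exact: ndf.
have L2 : \int[P]_w (f_ n (X w))%:E @[n --> \oo] --> \int[P]_w (h (X w))%:E.
  under [X in _ --> X]eq_integral => w _.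
    have -> : (h (X w))%:E = limn (fun n => (f_ n (X w))%:E).
      by apply/esym/cvg_lim.
    over.
  apply: cvg_monotone_convergence => //.
  by move=> n w _; rewrite lee_fin.
apply/esym; apply: cvg_unique L1 => //.
rewrite (_ : (fun n => _) = (fun n => c%:E * \int[P]_w (f_ n (X w))%:E)); last
    first.
  by apply/funext => n; exact: step.
exact: cvgeZl.
Qed.


(** Independence is the case where every factor is an indicator. The indicators
    are replaced by the given functions one at a time, each replacement being an
    instance of [integral_mul_indep] with the product of the other factors as
    weight. *)
Lemma integral_prod_indep d d' (Om : measurableType d) (T : measurableType d')
    (R : realType) (P : probability Om R) (n : nat) (X : 'I_n -> Om -> T) :
  (forall i, measurable_fun setT (X i)) ->
  (forall B : 'I_n -> set T, (forall i, measurable (B i)) ->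
     P (\bigcap_(i in [set: 'I_n]) (X i @^-1` B i)) =
     \prod_(i < n) P (X i @^-1` B i)) ->
  forall h : 'I_n -> T -> R,
  (forall i, measurable_fun setT (h i)) -> (forall i z, 0 <= h i z)%R ->
  (forall i, \int[P]_w (h i (X i w))%:E < +oo) ->
  \int[P]_w (\prod_(i < n) h i (X i w))%:E =
  \prod_(i < n) \int[P]_w (h i (X i w))%:E.
Proof.
move=> mX indX.
have mB B i : measurable B -> measurable (X i @^-1` B).
  by move=> ?; rewrite -[X in measurable X]setTI; exact: mX.
have key k : (k <= n)%N -> forall h : 'I_n -> T -> R,
    (forall i : 'I_n, (k <= i)%N -> exists2 B, measurable B & h i = \1_B) ->
    (forall i, measurable_fun setT (h i)) -> (forall i z, 0 <= h i z)%R ->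
    (forall i, \int[P]_w (h i (X i w))%:E < +oo) ->
    \int[P]_w (\prod_(i < n) h i (X i w))%:E =
    \prod_(i < n) \int[P]_w (h i (X i w))%:E.
  elim: k => [_|k IH kn] h hI mh h0 hoo.
    have /choice[B hB] : forall i, exists B, measurable B /\ h i = \1_B.
      by move=> i; have [B ? ?] := hI i (leq0n _); exists B.
    have iE (B' : set Om) : measurable B' ->
        \int[P]_w (\1_B' w : R)%:E = P B'.
      by move=> mB'; rewrite integral_indic// setIT.
    have -> : (fun w => (\prod_(i < n) h i (X i w))%:E) =
        (fun w => (\1_(\bigcap_(i in [set: 'I_n]) (X i @^-1` B i)) w : R)%:E).
      apply/funext => w; congr _%:E; rewrite indicE.
      case: (boolP (w \in _)) => [/[!inE] wB|wB].
        rewrite big1// => i _; rewrite (hB i).2 indicE mem_set//.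
        exact: wB.
      have [i Bi] : exists i, ~ B i (X i w).
        apply/existsNP => Bw; move/negP: wB; apply; rewrite inE => i _.
        exact: Bw.
      by rewrite (bigD1 i)//= (hB i).2 indicE memNset// mul0r.
    rewrite iE; last first.
      by apply: fin_bigcap_measurable => // i _; apply: mB; exact: (hB i).1.
    rewrite indX; last by move=> i; exact: (hB i).1.
    apply: eq_bigr => i _; rewrite -iE; last by apply: mB; exact: (hB i).1.
    by apply: eq_integral => w _; rewrite (hB i).2.
  (* the factor i0 is free; with any indicator in its place the induction
     hypothesis applies *)
  pose i0 := Ordinal kn.
  pose W w := (\prod_(i < n | i != i0) h i (X i w))%R.
  pose c := (\prod_(i < n | i != i0) fine (\int[P]_w (h i (X i w))%:E))%R.
  have fin i : \int[P]_w (h i (X i w))%:E \is a fin_num.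
    rewrite ge0_fin_numE//; apply: integral_ge0 => w _; by rewrite lee_fin.
  have cE : c%:E = \prod_(i < n | i != i0) \int[P]_w (h i (X i w))%:E.
    by rewrite /c -prodEFin; apply: eq_bigr => i _; rewrite fineK.
  rewrite (bigD1 i0)//= -cE muleC.
  rewrite -(@integral_mul_indep _ _ _ _ _ P (X i0) W)//.
  - apply: eq_integral => w _; congr _%:E; by rewrite (bigD1 i0).
  - rewrite /W; under eq_fun do rewrite -big_filter.
    by apply: measurable_prod => i _; exact: measurableT_comp (mh i) (mX i).
  - by move=> w; apply: prodr_ge0.
  - by apply: prodr_ge0 => i _; rewrite fine_ge0// integral_ge0// => w _;
      rewrite lee_fin.
  - move=> B mB'.
    pose h' i := if i == i0 then \1_B : T -> R else h i.
    have h'0 i : (i != i0) -> h' i = h i by rewrite /h' => /negbTE ->.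
    have h'E : h' i0 = \1_B by rewrite /h' eqxx.
    suff IHh : \int[P]_w (\prod_(i < n) h' i (X i w))%:E =
        \prod_(i < n) \int[P]_w (h' i (X i w))%:E.
      transitivity (\int[P]_w (\prod_(i < n) h' i (X i w))%:E).
        apply: eq_integral => w _; congr _%:E; rewrite [RHS](bigD1 i0)//= h'E.
        by congr (_ * _)%R; apply: eq_bigr => i ii0; rewrite h'0.
      rewrite IHh (bigD1 i0)//= h'E muleC cE; congr (_ * _).
      by apply: eq_bigr => i ii0; rewrite h'0.
    apply: IH (ltnW kn) _ _ _ _ _.
    + move=> i ki; rewrite /h'; case: eqP => [_|ii0]; first by exists B.
      apply: hI; rewrite ltn_neqAle ki andbT; apply/eqP => kE; apply: ii0.
      exact/val_inj.
    + move=> i; rewrite /h'; case: ifP => // _; exact: measurable_indic.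
    + by move=> i z; rewrite /h'; case: ifP.
    + move=> i; rewrite /h'; case: ifP => // _.
      apply: (@le_lt_trans _ _ (\int[P]_w (cst 1 w))); last first.
        by rewrite integral_cst//= probability_setT mule1 ltry.
      apply: ge0_le_integral => //.
      * apply/measurable_EFinP; exact: measurableT_comp (measurable_indic mB')
          (mX i).
      * by move=> w _; rewrite lee_fin indicE lern1 leq_b1.
by move=> h; apply: (key n) => // i; rewrite leqNgt ltn_ord.
Qed.

(** * Sub-exponential moments of products of coordinates *)

Local Close Scope ereal_scope.

(** For [x >= 0], apply [expR x - 1 <= x * expR x] twice. For [x = - y < 0],
    [expR (- y) <= (1 + y)^-1 <= 1 - y + y ^+ 2]. The term [x] is kept exact so
    that it integrates to 0 for a centred variable. *)
Lemma expR_le_quadratic (R : realType) (x : R) :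
  expR x <= 1 + x + x ^+ 2 * expR `|x|.
Proof.
have pos (y : R) : 0 <= y -> expR y - 1 <= y * expR y.
  move=> y0; have := expR_ge1Dx (- y).
  rewrite expRN => h; have e0 := expR_gt0 y.
  have : (1 - y) * expR y <= (expR y)^-1 * expR y by rewrite ler_wpM2r// ltW.
  rewrite mulVf ?gt_eqF//; lra.
have [x0|x0] := leP 0 x.
  rewrite ger0_norm//; have := pos _ x0; have e1 : 1 <= expR x by rewrite
      -expR0 ler_expR.
  move=> h; have : x * (expR x - 1) <= x * (x * expR x) by rewrite ler_wpM2l.
  rewrite expr2; nra.
rewrite ltr0_norm//; set y := - x; have y0 : 0 < y by rewrite oppr_gt0.
have -> : x = - y by rewrite opprK.
rewrite sqrrN expRN; have e1 : 1 + y <= expR y := expR_ge1Dx y.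
have e2 : 1 <= expR y by rewrite -expR0 ler_expR ltW.
have e0 := expR_gt0 y.
apply: (@le_trans _ _ (1 + y)^-1).
  by rewrite lef_pV2// posrE; lra.
have h : 1 - y + y ^+ 2 <= 1 - y + y ^+ 2 * expR y.
  by rewrite lerD2l ler_peMr// exprn_ge0// ltW.
apply: le_trans h; rewrite -[leRHS](mulKf (x:=1 + y)); last by rewrite gt_eqF;
    lra.
rewrite ler_peMr// ?invr_ge0; last 1 first.
  have -> : (1 + y) * (1 - y + y ^+ 2) = 1 + y ^+ 3 by ring.
  by rewrite lerDl exprn_ge0// ltW.
lra.
Qed.


Local Open Scope ereal_scope.

(** Integrate [expR_le_quadratic] at [lam * eta z]: the linear term vanishes and
    the remainder is dominated by the exponential moment, half of whose exponent
    pays for [expR (`|lam * eta z|)] and half for the square. *)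
Lemma mgf_subgaussian d (T : measurableType d) (R : realType)
    (mu : probability T R) (eta : T -> R) (kappa K lam : R) :
  mu.-integrable setT (EFin \o eta) ->
  \int[mu]_z (eta z)%:E = 0 ->
  (0 < kappa)%R ->
  \int[mu]_z (expR (kappa * `|eta z|))%:E <= K%:E ->
  (`|lam| <= kappa / 2)%R ->
  \int[mu]_z (expR (lam * eta z))%:E <=
    (expR (16 * K / kappa ^+ 2 * lam ^+ 2))%:E.
Proof.
move=> ieta eta0 k0 expK lamk.
have meta : measurable_fun setT eta by exact/measurable_EFinP/(measurable_int _
    ieta).
pose D := (16 / kappa ^+ 2 * lam ^+ 2)%R.
have D0 : (0 <= D)%R by rewrite /D mulr_ge0 ?sqr_ge0// divr_ge0 ?sqr_ge0.
have mexp : measurable_fun setT (fun z => expR (kappa * `|eta z|)).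
  apply: measurableT_comp => //; apply: measurable_funM => //.
  exact: measurableT_comp.
have iexp : mu.-integrable setT (fun z => (expR (kappa * `|eta z|))%:E).
  apply/integrableP; split; first exact/measurable_EFinP.
  under eq_integral do rewrite gee0_abs ?lee_fin ?expR_ge0//.
  by apply: le_lt_trans expK _; rewrite ltry.
have pw z : (expR (lam * eta z) <=
    1 + lam * eta z + D * expR (kappa * `|eta z|))%R.
  apply: (le_trans (expR_le_quadratic _)); rewrite lerD2l /D.
  (* u ^+ 2 <= expR (2 u), which uses up half of the exponent 4 u *)
  set u := (kappa * `|eta z| / 4)%R.
  have u0 : (0 <= u)%R by rewrite /u divr_ge0// mulr_ge0// ltW.
  have u1 : (u <= expR u)%R by have := expR_ge1Dx u; lra.
  have u2 : (u ^+ 2 <= expR (u *+ 2))%R.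
    by rewrite -mulr_natl expRM_natl ler_pXn2r// nnegrE// expR_ge0.
  have -> : ((lam * eta z) ^+ 2 = 16 / kappa ^+ 2 * lam ^+ 2 * u ^+ 2)%R.
    by rewrite exprMn -(real_normK (num_real (eta z))) /u; field; rewrite
        gt_eqF.
  rewrite -[leLHS]mulrA ler_wpM2l//.
  have -> : (kappa * `|eta z| = u *+ 2 + u *+ 2)%R by rewrite /u; field.
  rewrite expRD ler_pM// ?sqr_ge0 ?expR_ge0// ler_expR normrM.
  have -> : (u *+ 2 = kappa / 2 * `|eta z|)%R by rewrite /u; field.
  by rewrite ler_wpM2r.
have i1 : mu.-integrable setT (cst 1 : T -> \bar R).
  by apply/integrableP; split => //; under eq_integral do rewrite /= normr1;
     rewrite integral_cst//= mul1e probability_setT ltry.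
have i2 : mu.-integrable setT (fun z => lam%:E * (eta z)%:E).
  exact: integrableZl.
have i12 : mu.-integrable setT (fun z => 1 + lam%:E * (eta z)%:E).
  exact: integrableD.
have i3 : mu.-integrable setT (fun z => D%:E * (expR (kappa * `|eta z|))%:E).
  exact: integrableZl.
apply: (@le_trans _ _ (\int[mu]_z (1 + lam%:E * (eta z)%:E +
   D%:E * (expR (kappa * `|eta z|))%:E))).
  apply: ge0_le_integral => //.
  - apply/measurable_EFinP/measurableT_comp => //; exact: measurable_funM.
  - exact: (measurable_int _ (integrableD measurableT i12 i3)).
  - by move=> z _; rewrite -!EFinM -!EFinD lee_fin.
rewrite integralD// integralD// integralZl// eta0 mule0 adde0.
rewrite integralZl// integral_cst//= mul1e probability_setT.
apply: (@le_trans _ _ (1 + D%:E * K%:E)).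
  by rewrite leeD2l// lee_wpmul2l// lee_fin.
rewrite -EFinM -EFinD lee_fin; apply: le_trans (expR_ge1Dx _) _.
by rewrite ler_expR /D le_eqVlt; apply/orP; left; apply/eqP; ring.
Qed.


Definition second_moment {R : realType} {p : nat} (mu : probability (obs R p) R)
    (j k : 'I_p.+1) : R :=
  fine 'E_mu[fun z => tnth z j * tnth z k]%R.

(** The sub-exponential condition common to all the classes with exponent
    [1 <= q <= +oo]. *)
Definition uniform_mgf {R : realType} {p : nat} (mu : probability (obs R p) R)
    (kappa K : R) : Prop :=
  forall j k : 'I_p.+1,
    mu.-integrable setT (fun z => (tnth z j * tnth z k)%:E) /\
    \int[mu]_z (expR (kappa * `|tnth z j * tnth z k - second_moment mu j k|))%:E
      <= K%:E.

(** Since [q >= 1], [u <= 1 + u `^ q] for [u >= 0], so that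
    [expR u <= expR 1 * (psi_exp q u + 1)]. *)
Lemma psi_exp_mgf d (T : measurableType d) (R : realType)
    (mu : probability T R) (eta : T -> R) (q C : R) :
  measurable_fun setT eta -> (1 <= q)%R ->
  orlicz_norm mu (psi_exp q) eta <= C%:E ->
  \int[mu]_z (expR ((`|C| + 1)^-1 * `|eta z|))%:E <= (2 * expR 1)%:E.
Proof.
move=> meta q1 normC.
have [_ [c [c0 Ec] <-] cC] : exists2 x, [set c%:E | c in
    [set c : R | (0 < c)%R /\ 'E_mu[fun z => psi_exp q (`|eta z| / c)%R] <= 1]]
        x
    & x < (`|C| + 1)%:E.
  apply: ereal_inf_lt; apply: le_lt_trans normC _.
  by rewrite lte_fin; have := ler_norm C; lra.
rewrite lte_fin in cC.
have mx : measurable_fun setT (fun z => (`|eta z| / c)%R).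
  apply: measurable_funM => //; exact: measurableT_comp.
have psi0 z : (0 <= psi_exp q (`|eta z| / c))%R.
  by rewrite /psi_exp subr_ge0 -expR0 ler_expR powR_ge0.
have mpsi : measurable_fun setT (fun z => (psi_exp q (`|eta z| / c))%:E).
  apply/measurable_EFinP; apply: measurable_funB => //.
  apply: measurableT_comp => //; exact: (measurableT_comp (measurable_powR _)).
have pw z : (expR ((`|C| + 1)^-1 * `|eta z|) <=
    expR 1 * (psi_exp q (`|eta z| / c) + 1))%R.
  rewrite /psi_exp subrK -expRD ler_expR.
  set x := (`|eta z| / c)%R.
  have x0 : (0 <= x)%R by rewrite divr_ge0// ltW.
  apply: (@le_trans _ _ x).
    by rewrite /x mulrC ler_wpM2l// lef_pV2 ?posrE ?ltW//; apply: lt_trans cC.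
  have [x1|x1] := leP x 1%R; first by rewrite ler_wpDr// powR_ge0.
  rewrite ler_wpDl// -{1}[x]powRr1// ler_powR// ltW//.
have mexp : measurable_fun setT (fun z => (expR ((`|C| + 1)^-1 * `|eta z|))%:E).
  apply/measurable_EFinP; apply: measurableT_comp => //.
  apply: measurable_funM => //; exact: measurableT_comp.
apply: (@le_trans _ _
   (\int[mu]_z ((expR 1)%:E * ((psi_exp q (`|eta z| / c))%:E + 1)))).
  apply: ge0_le_integral => //.
  - by apply: emeasurable_funM => //; exact: emeasurable_funD.
  - by move=> z _; rewrite -EFinD -EFinM lee_fin.
rewrite ge0_integralZl//; last 2 first.
- exact: emeasurable_funD.
- by move=> z _; rewrite adde_ge0// lee_fin.
rewrite ge0_integralD//; last by move=> z _; rewrite lee_fin.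
rewrite integral_cst//= probability_setT mule1 mulrC EFinM.
rewrite lee_wpmul2l ?lee_fin ?expR_ge0//.
move: Ec; rewrite unlock => Ec.
by rewrite (_ : 2%:E = 1 + 1 :> \bar R) ?leeD2r// -EFinD.
Qed.

Lemma bounded_mgf d (T : measurableType d) (R : realType)
    (mu : probability T R) (xi : T -> R) (C : R) :
  measurable_fun setT xi -> (0 < C)%R ->
  {ae mu, forall z, (`|xi z| <= C)%R} ->
  mu.-integrable setT (EFin \o xi) /\
  \int[mu]_z (expR ((2 * C)^-1 * `|xi z - fine 'E_mu[xi]|))%:E <= (expR 1)%:E.
Proof.
move=> mxi C0 aeC.
have mExi : measurable_fun setT (EFin \o xi) by exact/measurable_EFinP.
have absC : \int[mu]_z `|(xi z)%:E| <= C%:E.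
  apply: (@le_trans _ _ (\int[mu]_z (cst C%:E z))); last first.
    by rewrite integral_cst//= probability_setT mule1.
  apply: ae_ge0_le_integral => //.
  - exact: measurableT_comp.
  - by move=> z _; rewrite lee_fin ltW.
  - by apply: filterS aeC => z zC _; rewrite lee_fin.
have ixi : mu.-integrable setT (EFin \o xi).
  by apply/integrableP; split => //; apply: le_lt_trans absC _; rewrite ltry.
split => //.
have EC : (`|fine 'E_mu[xi]| <= C)%R.
  rewrite -lee_fin; apply: le_trans absC; rewrite unlock.
  have fin : \int[mu]_w (xi w)%:E \is a fin_num by exact: integrable_fin_num.
  by rewrite -fine_abse// fineK ?abse_fin_num//; exact: le_abse_integral.
apply: (@le_trans _ _ (\int[mu]_z (cst (expR 1)%:E z))); last first.
  by rewrite integral_cst//= probability_setT mule1.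
apply: ae_ge0_le_integral => //.
- apply/measurable_EFinP; apply: measurableT_comp => //.
  apply: measurable_funM => //; apply: measurableT_comp => //.
  exact: measurable_funB.
- by move=> z _; rewrite lee_fin expR_ge0.
- apply: filterS aeC => z zC _; rewrite lee_fin ler_expR.
  rewrite mulrC ler_pdivrMr ?mulr_gt0// mul1r.
  by apply: le_trans (ler_normB _ _) _; lra.
Qed.

Lemma dist_class_mgf (R : realType) (q : \bar R) (Cq : R) (p : nat -> nat)
    (mu : forall n, probability (obs R (p n)) R) :
  1 <= q -> dist_class q Cq mu ->
  exists kappa K : R, [/\ (0 < kappa)%R, (0 < K)%R &
    forall n, uniform_mgf (mu n) kappa K].
Proof.
have mxi n (j k : 'I_(p n).+1) :
    measurable_fun setT (fun z : obs R (p n) => (tnth z j * tnth z k)%R).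
  by apply: measurable_funM; exact: measurable_tnth.
case: q => [q| |] q1 //= hmu.
- exists ((`|Cq| + 1)^-1)%R, (2 * expR 1)%R; split.
  + by rewrite invr_gt0 ltr_wpDl.
  + by rewrite mulr_gt0// expR_gt0.
  move=> n j k; have [ixi xiC] := hmu n j k; split => //.
  apply: psi_exp_mgf xiC; [|by rewrite lee_fin in q1].
  by apply: measurable_funB; [exact: mxi|exact: measurable_cst].
- exists ((2 * (`|Cq| + 1) ^+ 2)^-1)%R, (expR 1); split.
  + by rewrite invr_gt0 mulr_gt0// exprn_gt0// ltr_wpDl.
  + exact: expR_gt0.
  move=> n j k; apply: bounded_mgf; [exact: mxi|by rewrite exprn_gt0//
      ltr_wpDl|].
  move: (hmu n j) (hmu n k); apply: filterS2 => z zj zk.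
  have C1 : (Cq <= `|Cq| + 1)%R by have := ler_norm Cq; lra.
  by rewrite normrM expr2 ler_pM//; exact: le_trans C1.
Qed.

(** * Concentration of empirical second moments *)


Definition deviation {R : realType} {p n : nat} (mu : probability (obs R p) R)
    (S : {set 'I_n}) (z : 'I_n -> obs R p) (jk : 'I_p.+1 * 'I_p.+1) : R :=
  (#|S|%:R^-1 * \sum_(i in S) (tnth (z i) jk.1 * tnth (z i) jk.2)
   - second_moment mu jk.1 jk.2)%R.

Lemma deviationE (R : realType) (p n : nat) (mu : probability (obs R p) R)
    (S : {set 'I_n}) (z : 'I_n -> obs R p) (jk : 'I_p.+1 * 'I_p.+1) :
  (0 < #|S|)%N ->
  deviation mu S z jk = (#|S|%:R^-1 * \sum_(i in S)
    (tnth (z i) jk.1 * tnth (z i) jk.2 - second_moment mu jk.1 jk.2))%R.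
Proof.
move=> S0; rewrite sumrB mulrBr sumr_const -[X in _ = (_ - _ * X)%R]mulr_natl.
by rewrite mulKf// pnatr_eq0 -lt0n.
Qed.

Lemma integral_iid (R : realType) (p n : nat) (mu : probability (obs R p) R)
    d (Omega : measurableType d) (P : probability Omega R)
    (Z : 'I_n -> {RV P >-> obs R p}) (f : obs R p -> \bar R) i :
  iid_sample mu Z -> measurable_fun setT f -> (forall z, 0 <= f z) ->
  \int[P]_w f (Z i w) = \int[mu]_z f z.
Proof.
move=> [dZ _] mf f0; rewrite -(ge0_integral_distribution (Z i))//.
by apply: eq_measure_integral => B mB _; exact: dZ.
Qed.

(** Each observation of [S] enters with weight [s / #|S|], hence contributes a
    factor [expR (A * (s / #|S|) ^+ 2)] with [A = 16 * K / kappa ^+ 2]; the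
    #|S| factors multiply to [expR (A * s ^+ 2 / #|S|)]. *)
Lemma mgf_deviation (R : realType) (p n : nat) (mu : probability (obs R p) R)
    (kappa K : R) d (Omega : measurableType d) (P : probability Omega R)
    (Z : 'I_n -> {RV P >-> obs R p}) (S : {set 'I_n}) (N s : R)
    (jk : 'I_p.+1 * 'I_p.+1) :
  (0 < kappa)%R -> (0 < K)%R -> uniform_mgf mu kappa K -> iid_sample mu Z ->
  (0 < N)%R -> (N <= #|S|%:R)%R -> (`|s| <= kappa / 2 * N)%R ->
  \int[P]_w (expR (s * deviation mu S (fun i => Z i w) jk))%:E <=
    (expR (16 * K / kappa ^+ 2 * s ^+ 2 / N))%:E.
Proof.
move=> k0 K0 mgf iid N0 NS sN.
have S0 : (0 < #|S|%:R :> R)%R by apply: lt_le_trans NS.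
have S0' : (0 < #|S|)%N by rewrite ltr0n in S0.
pose eta (z : obs R p) :=
  (tnth z jk.1 * tnth z jk.2 - second_moment mu jk.1 jk.2)%R.
pose lam := (s / #|S|%:R)%R.
have meta : measurable_fun setT eta.
  apply: measurable_funB => //; apply: measurable_funM; exact: measurable_tnth.
have [ixi mgfxi] := mgf jk.1 jk.2.
have ieta : mu.-integrable setT (EFin \o eta).
  have -> : EFin \o eta = (fun z => (tnth z jk.1 * tnth z jk.2)%:E -
      (cst (second_moment mu jk.1 jk.2)%:E z)) by apply/funext.
  apply: integrableB => //; exact: finite_measure_integrable_cst.
have eta0 : \int[mu]_z (eta z)%:E = 0.
  under eq_integral do rewrite EFinB.
  rewrite integralB//; last exact: finite_measure_integrable_cst.
  rewrite integral_cst//= probability_setT mule1 /second_moment unlock fineK.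
    by rewrite subee// integrable_fin_num.
  exact: integrable_fin_num.
have lamk : (`|lam| <= kappa / 2)%R.
  rewrite /lam normrM normfV (ger0_norm (ltW S0)) ler_pdivrMr//.
  by apply: le_trans sN _; rewrite ler_wpM2l// divr_ge0// ltW.
set A := (16 * K / kappa ^+ 2)%R.
have mgfle : \int[mu]_z (expR (lam * eta z))%:E <= (expR (A * lam ^+ 2))%:E.
  exact: mgf_subgaussian.
have mexp : measurable_fun setT (fun z => expR (lam * eta z)).
  by apply: measurableT_comp => //; exact: measurable_funM.
pose h i z := if i \in S then expR (lam * eta z) else 1%R.
have mh i : measurable_fun setT (h i).
  rewrite /h; case: (i \in S) => //; exact: measurable_cst.
have h0 i z : (0 <= h i z)%R by rewrite /h; case: ifP => // _; exact: expR_ge0.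
have inth i : \int[P]_w (h i (Z i w))%:E <=
    (if i \in S then expR (A * lam ^+ 2) else 1)%:E.
  rewrite (integral_iid (f := EFin \o h i) i iid)//; last 2 first.
    - exact/measurable_EFinP.
    - by move=> z; rewrite lee_fin.
  rewrite /h /=; case: (i \in S) => //.
  by rewrite (integral_cst _ _ 1)//= probability_setT mule1.
have -> : \int[P]_w (expR (s * deviation mu S (fun i => Z i w) jk))%:E =
    \int[P]_w (\prod_(i < n) h i (Z i w))%:E.
  apply: eq_integral => w _; congr _%:E.
  rewrite deviationE// mulrA mulr_sumr expR_sum /h big_mkcond.
  by apply: eq_bigr => i _; case: ifP.
rewrite (integral_prod_indep (X := fun i => Z i)); last 5 first.
- by move=> i.
- move=> B mB; have := iid.2 finset.setT B mB.
  rewrite (_ : [set` _] = setT); last by apply/seteqP; split => i //=; rewrite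
      finset.in_setT.
  by move=> ->; apply: eq_bigl => i; rewrite finset.in_setT.
- exact: mh.
- exact: h0.
- move=> i; apply: le_lt_trans (inth i) _; exact: ltry.
apply: (@le_trans _ _ (\prod_(i < n) (if i \in S then expR (A * lam ^+ 2) else
    1)%:E)).
  suff [] : 0 <= \prod_(i < n) \int[P]_w (h i (Z i w))%:E /\
      \prod_(i < n) \int[P]_w (h i (Z i w))%:E <=
      \prod_(i < n) (if i \in S then expR (A * lam ^+ 2) else 1)%:E by [].
  elim/big_ind2 : _ => // [x1 x2 y1 y2 [x0 xle] [y0 yle]|i _].
    by split; [exact: mule_ge0|exact: lee_pmul].
  by split; [apply: integral_ge0 => w _; rewrite lee_fin|exact: inth].
rewrite prodEFin -big_mkcond prodr_const lee_fin -expRM_natl ler_expR.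
rewrite /lam -/A.
have -> : (#|S|%:R * (A * (s / #|S|%:R) ^+ 2) = A * s ^+ 2 / #|S|%:R)%R.
  by field; rewrite gt_eqF.
apply: ler_wpM2l; last by rewrite lef_pV2 ?posrE.
by rewrite mulr_ge0 ?sqr_ge0// divr_ge0 ?sqr_ge0// mulr_ge0// ltW.
Qed.

Definition max_deviation {R : realType} {p n : nat} (mu : probability (obs R p)
    R)
    (J : {set 'I_p.+1 * 'I_p.+1}) (S : {set 'I_n}) (z : 'I_n -> obs R p) : R :=
  (\big[Num.max/0]_(jk in J) `|deviation mu S z jk|)%R.

Definition average {R : realType} {n : nat} (V : {set {set 'I_n}})
    (f : {set 'I_n} -> R) : R :=
  (#|V|%:R^-1 * \sum_(v in V) f v)%R.

(** If the average over [v] of the maxima [M v] exceeds [x], then the average of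
    [1 + s * (M v - x)] is at least 1, and so is the average of
    [expR (s * (M v - x))]. The latter is bounded by a sum over [J] of moment
    generating functions, so that Markov's inequality costs a factor #|J| but no
    factor #|V|. The exceptional set is the measurable event where that sum is
    at least 1. *)
Lemma averaged_tail (R : realType) (p n : nat) (mu : probability (obs R p) R)
    (kappa K : R) d (Omega : measurableType d) (P : probability Omega R)
    (Z : 'I_n -> {RV P >-> obs R p}) (V : {set {set 'I_n}})
    (F : {set 'I_n} -> {set 'I_n}) (J : {set 'I_p.+1 * 'I_p.+1}) (N s x : R) :
  (0 < kappa)%R -> (0 < K)%R -> uniform_mgf mu kappa K -> iid_sample mu Z ->
  (0 < N)%R -> (0 < s)%R -> (s <= kappa / 2 * N)%R ->
  V != finset.set0 -> J != finset.set0 ->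
  (forall v, v \in V -> (N <= #|F v|%:R)%R) ->
  exists B, [/\ measurable B,
    P B <= (2 * #|J|%:R * expR (16 * K / kappa ^+ 2 * s ^+ 2 / N - s * x))%:E &
    forall w, ~ B w ->
      (average V (fun v => max_deviation mu J (F v) (fun i => Z i w)) <= x)%R].
Proof.
move=> k0 K0 mgf iid N0 s0 sN V0 J0 FN.
pose D v jk w := deviation mu (F v) (fun i => Z i w) jk.
pose e a v jk w := expR (a * D v jk w).
pose g v w := (\sum_(jk in J) (e s v jk w + e (- s) v jk w))%R.
pose G w := (#|V|%:R^-1 * expR (- (s * x)) * \sum_(v in V) g v w)%R.
have V1 : (0 < #|V|%:R :> R)%R by rewrite ltr0n card_gt0.
have mD v jk : measurable_fun setT (D v jk).
  apply: measurable_funB => //; apply: measurable_funM => //.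
  under eq_fun do rewrite -big_filter.
  apply: measurable_sum => i; apply: measurable_funM;
    exact: measurableT_comp (measurable_tnth _) _.
have me a v jk : measurable_fun setT (e a v jk).
  by apply: measurableT_comp => //; exact: measurable_funM.
have e0 a v jk w : (0 <= e a v jk w)%R by exact: expR_ge0.
have mg v : measurable_fun setT (g v).
  rewrite /g; under eq_fun do rewrite -big_filter.
  by apply: measurable_sum => jk; exact: measurable_funD.
have g0 v w : (0 <= g v w)%R by apply: sumr_ge0 => jk _; exact: addr_ge0.
have mG : measurable_fun setT G.
  apply: measurable_funM => //.
  under eq_fun do rewrite -big_filter.
  by apply: measurable_sum => v; exact: mg.
have G0 w : (0 <= G w)%R.
  by rewrite mulr_ge0 ?sumr_ge0// mulr_ge0 ?expR_ge0// invr_ge0 ltW.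
have mB : measurable [set w | (1 <= G w)%R].
  have -> : [set w | (1 <= G w)%R] = setT `&` (G @^-1` `[1%R, +oo[).
    by apply/seteqP; split => w /=; rewrite in_itv/= andbT; [split|case].
  exact: mG.
exists [set w | (1 <= G w)%R]; split => //.
- set E := (expR (16 * K / kappa ^+ 2 * s ^+ 2 / N))%R.
  apply: (@le_trans _ _ (\int[P]_w (G w)%:E)).
    rewrite -(setIT [set w | _]) -integral_indic//; apply: ge0_le_integral =>
        //.
    + apply/measurable_EFinP; exact: measurable_indic.
    + exact/measurable_EFinP.
    + move=> w _; rewrite lee_fin indicE; case: (boolP (w \in _)) => // /[!inE].
      by [].
  have ig v : v \in V -> \int[P]_w (g v w)%:E <= (2 * #|J|%:R * E)%:E.
    move=> vV; under eq_integral do rewrite /g -sumEFin -big_filter.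
    rewrite ge0_integral_sum//; last 2 first.
      + by move=> jk; apply/measurable_EFinP; exact: measurable_funD.
      + by move=> jk w _; rewrite lee_fin addr_ge0.
    rewrite big_filter.
    apply: (@le_trans _ _ (\sum_(jk in J) (2 * E)%:E)); last first.
      by rewrite sumEFin sumr_const -[X in X%:E <= _]mulr_natl mulrCA mulrA.
    apply: lee_sum => jk _; under eq_integral do rewrite EFinD.
    rewrite ge0_integralD//; try exact/measurable_EFinP; try by move=> w _;
        rewrite lee_fin.
    rewrite mulr2n mulrDl mul1r EFinD; apply: leeD; rewrite /E.
      apply: mgf_deviation => //; [exact: FN|by rewrite gtr0_norm].
    rewrite -(sqrrN s); apply: mgf_deviation => //; first exact: FN.
    by rewrite normrN gtr0_norm.
  rewrite /G; under eq_integral do rewrite EFinM.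
  rewrite ge0_integralZl//; last 2 first.
    + apply/measurable_EFinP; under eq_fun do rewrite -big_filter.
      by apply: measurable_sum => v; exact: mg.
    + by move=> w _; rewrite lee_fin sumr_ge0.
  under eq_integral do rewrite -sumEFin -big_filter.
  rewrite ge0_integral_sum//; last 2 first.
    + by move=> v; apply/measurable_EFinP.
    + by move=> v w _; rewrite lee_fin.
  rewrite big_filter.
  apply: (@le_trans _ _ ((#|V|%:R^-1 * expR (- (s * x)))%:E *
      \sum_(v in V) (2 * #|J|%:R * E)%:E)).
    apply: lee_wpmul2l; last exact: lee_sum.
    by rewrite lee_fin mulr_ge0 ?expR_ge0// invr_ge0 ltW.
  rewrite sumEFin sumr_const -EFinM lee_fin -/E expRD -/E.
  rewrite -[X in (_ * X)%R]mulr_natl le_eqVlt; apply/orP; left; apply/eqP.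
  by field; rewrite gt_eqF.
- move=> w /= /negP; rewrite -ltNge => Gw; rewrite leNgt; apply/negP => xlt.
  move: Gw; apply/negP; rewrite -leNgt.
  pose M v := max_deviation mu J (F v) (fun i => Z i w).
  have gM v : (expR (s * M v) <= g v w)%R.
    have [jk0 jk0J] := set0Pn _ J0.
    have [jk jkJ ->] : exists2 jk, jk \in J & M v = `|D v jk w|%R.
      rewrite /M /max_deviation (bigmax_eq_arg _ jk0)//.
      by case: arg_maxP => // jk jkJ _; exists jk.
    rewrite /g (bigD1 jk)//= ler_wpDr//.
      by apply: sumr_ge0 => ? _; exact: addr_ge0.
    rewrite /e; have [D0|D0] := leP 0%R (D v jk w).
      by rewrite ger0_norm// ler_wpDr ?expR_ge0.
    by rewrite ltr0_norm// mulrN -mulNr ler_wpDl ?expR_ge0.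
  apply: (@le_trans _ _ (#|V|%:R^-1 * \sum_(v in V) (1 + s * (M v - x)))%R).
    rewrite big_split/= sumr_const mulrDr -mulr_sumr mulVf ?gt_eqF// lerDl.
    rewrite sumrB sumr_const mulrCA; apply: mulr_ge0; first exact: ltW.
    rewrite mulrBr subr_ge0.
    by rewrite -[(x *+ _)%R]mulr_natl mulKf ?gt_eqF// ltW.
  rewrite /G -mulrA; apply: ler_wpM2l; first by rewrite invr_ge0 ltW.
  rewrite mulr_sumr; apply: ler_sum => v vV.
  apply: le_trans (expR_ge1Dx _) _.
  by rewrite mulrBr addrC expRD ler_wpM2l ?expR_ge0//; exact: gM.
Qed.

Local Close Scope ereal_scope.

(** * Risk as a quadratic form in the second moments *)

(** The vector [(1, - beta)], whose pairing with an observation is the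
    residual. *)
Definition contrast {R : realType} {p : nat} (beta : 'rV[R]_p) (j : 'I_p.+1) :
    R :=
  if unlift ord0 j is Some j' then - beta 0 j' else 1.

Lemma sq_lossE (R : realType) (p : nat) (z : obs R p) (beta : 'rV[R]_p) :
  sq_loss z beta = \sum_j \sum_k
    contrast beta j * contrast beta k * (tnth z j * tnth z k).
Proof.
have -> : sq_loss z beta = (\sum_j contrast beta j * tnth z j) ^+ 2.
  rewrite /sq_loss big_ord_recl /contrast unlift_none mul1r /response /thead.
  congr ((_ + _) ^+ 2); rewrite -sumrN; apply: eq_bigr => j _.
  rewrite liftK tnth_behead mulNr mulrC; congr (- (_ * tnth z _)).
  by apply/val_inj; rewrite /= inordK ?ltnS// lift0.
rewrite expr2 big_distrl; apply: eq_bigr => j _; rewrite big_distrr.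
by apply: eq_bigr => k _; rewrite mulrACA.
Qed.

Lemma risk_secondE (R : realType) (p : nat) (mu : probability (obs R p) R)
    (beta : 'rV[R]_p) :
  (forall j k, mu.-integrable setT (fun z => (tnth z j * tnth z k)%:E)) ->
  risk mu beta = (\sum_j \sum_k
    contrast beta j * contrast beta k * second_moment mu j k)%:E.
Proof.
move=> int; rewrite /risk unlock.
have iz j k : mu.-integrable setT
    (fun z => (contrast beta j * contrast beta k)%:E * (tnth z j * tnth z
        k)%:E)%E.
  exact: integrableZl.
under eq_integral do rewrite sq_lossE -sumEFin.
rewrite integral_sum//; last first.
  move=> j; under eq_fun do rewrite -sumEFin.
  by apply: integrable_sum => // k _; exact: iz.
rewrite -sumEFin; apply: eq_bigr => j _.
under eq_integral do rewrite -sumEFin.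
rewrite integral_sum//; last by move=> k; exact: iz.
rewrite -sumEFin; apply: eq_bigr => k _.
under eq_integral do rewrite EFinM.
rewrite integralZl// [RHS]EFinM /second_moment unlock fineK//.
exact: integrable_fin_num (int j k).
Qed.

Lemma empirical_risk_deviation (R : realType) (p n : nat)
    (mu : probability (obs R p) R) (S : {set 'I_n}) (z : 'I_n -> obs R p)
    (beta : 'rV[R]_p) :
  (forall j k, mu.-integrable setT (fun z => (tnth z j * tnth z k)%:E)) ->
  empirical_risk S z beta - fine (risk mu beta) =
  \sum_j \sum_k contrast beta j * contrast beta k * deviation mu S z (j, k).
Proof.
move=> int; rewrite risk_secondE//= /empirical_risk.
rewrite (eq_bigr _ (fun i _ => sq_lossE (z i) beta)).
rewrite exchange_big/= mulr_sumr -sumrB; apply: eq_bigr => j _.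
rewrite exchange_big/= mulr_sumr -sumrB; apply: eq_bigr => k _.
by rewrite -mulr_sumr mulrCA -mulrBr.
Qed.

Lemma l1_ball_norm_contrast (R : realType) (p : nat) (t : R) (beta : 'rV[R]_p) :
  l1_ball t beta -> \sum_j `|contrast beta j| <= 1 + t.
Proof.
rewrite /l1_ball /= => bt; rewrite big_ord_recl /contrast unlift_none normr1.
rewrite lerD2l; apply: le_trans bt; rewrite le_eqVlt; apply/orP; left;
    apply/eqP.
by apply: eq_bigr => j _; rewrite liftK normrN.
Qed.

Lemma deviation_le_max (R : realType) (p n : nat) (mu : probability (obs R p) R)
    (J : {set 'I_p.+1 * 'I_p.+1}) (S : {set 'I_n}) (z : 'I_n -> obs R p) jk :
  jk \in J -> `|deviation mu S z jk| <= max_deviation mu J S z.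
Proof. by move=> jkJ; apply: le_bigmax_cond. Qed.

Lemma max_deviation_ge0 (R : realType) (p n : nat) (mu : probability (obs R p)
    R)
    (J : {set 'I_p.+1 * 'I_p.+1}) (S : {set 'I_n}) (z : 'I_n -> obs R p) :
  0 <= max_deviation mu J S z.
Proof. exact: bigmax_ge_id. Qed.

(** The entry (0, 0) is kept apart because its weight in the quadratic form does
    not shrink with the radius. When [ln p] is comparable to [b] the maximal
    deviation over all entries need not tend to 0, and only its small weight
    makes its contribution negligible. *)
Definition risk_error {R : realType} {p n : nat} (mu : probability (obs R p) R)
    (z : 'I_n -> obs R p) (t : R) (S : {set 'I_n}) : R :=
  max_deviation mu [set (ord0, ord0)]%SET S z
  + (2 * t + t ^+ 2) * max_deviation mu finset.setT S z.

(** The weights [`|gamma_j gamma_k|] sum to at most [(1 + s) ^+ 2], of which the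
    entry (0, 0) accounts for exactly 1. *)
Lemma empirical_risk_error (R : realType) (p n : nat)
    (mu : probability (obs R p) R) (S : {set 'I_n}) (z : 'I_n -> obs R p)
    (t s : R) (beta : 'rV[R]_p) :
  (forall j k, mu.-integrable setT (fun z => (tnth z j * tnth z k)%:E)) ->
  0 <= t -> t <= s -> l1_ball t beta ->
  `|empirical_risk S z beta - fine (risk mu beta)| <= risk_error mu z s S.
Proof.
move=> int t0 ts bt; rewrite empirical_risk_deviation//.
set D := max_deviation mu finset.setT S z.
have D0 : 0 <= D by exact: max_deviation_ge0.
have c0 : contrast beta ord0 = 1 by rewrite /contrast unlift_none.
rewrite pair_big/=; rewrite (bigD1 (ord0, ord0))//=.
apply: le_trans (ler_normD _ _) _; apply: lerD.
  rewrite c0 !mul1r; apply: deviation_le_max.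
  by rewrite finset.in_set1.
apply: le_trans (ler_norm_sum _ _ _) _.
have sum_le : \sum_(jk : 'I_p.+1 * 'I_p.+1 | jk != (ord0, ord0))
    `|contrast beta jk.1 * contrast beta jk.2| <= 2 * s + s ^+ 2.
  have : \sum_(jk : 'I_p.+1 * 'I_p.+1)
      `|contrast beta jk.1 * contrast beta jk.2| <= (1 + s) ^+ 2.
    rewrite -(pair_big xpredT xpredT (fun j k => `|contrast beta j * contrast
        beta k|))/=.
    under eq_bigr => j _ do (under eq_bigr do rewrite normrM; rewrite
        -mulr_sumr).
    rewrite -mulr_suml -expr2 ler_pXn2r ?nnegrE//.
    - by apply: le_trans (l1_ball_norm_contrast bt) _; rewrite lerD2l.
    - exact: sumr_ge0.
    - by rewrite addr_ge0// (le_trans t0).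
  rewrite (bigD1 (ord0, ord0))//= c0 mul1r normr1.
  by rewrite (_ : (1 + s) ^+ 2 = 1 + (2 * s + s ^+ 2)) ?lerD2l//; ring.
apply: le_trans (ler_wpM2r D0 sum_le); rewrite mulr_suml; apply: ler_sum.
move=> [j k] _; rewrite normrM ler_wpM2l//; apply: deviation_le_max.
by rewrite finset.in_setT.
Qed.

(** * Excess risk of the cross-validated lasso *)

Lemma lasso_risk_le (R : realType) (p n : nat)
    (mu : probability (obs R p) R) (S : {set 'I_n}) (z : 'I_n -> obs R p)
    (s smax : R) (bhat beta : 'rV[R]_p) :
  (forall j k, mu.-integrable setT (fun z => (tnth z j * tnth z k)%:E)) ->
  0 <= s -> s <= smax ->
  is_argmin (empirical_risk S z) (l1_ball s) bhat -> l1_ball s beta ->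
  fine (risk mu bhat) <= fine (risk mu beta) + 2 * risk_error mu z smax S.
Proof.
move=> int s0 ss [bs bmin] betas.
have := empirical_risk_error S z int s0 ss bs.
have := empirical_risk_error S z int s0 ss betas.
have := bmin _ betas; rewrite !ler_norml; lra.
Qed.

Lemma average_le (R : realType) (n : nat) (V : {set {set 'I_n}})
    (f g : {set 'I_n} -> R) :
  (forall v, v \in V -> f v <= g v) -> average V f <= average V g.
Proof. by move=> fg; rewrite ler_wpM2l ?invr_ge0//; exact: ler_sum. Qed.

Lemma average_affine (R : realType) (n : nat) (V : {set {set 'I_n}})
    (f g : {set 'I_n} -> R) (a b c : R) : V != finset.set0 ->
  average V (fun v => a + b * f v + c * g v) = a + b * average V f + c *
      average V g.
Proof.
move=> V0; have V1 : #|V|%:R != 0 :> R by rewrite pnatr_eq0 -lt0n card_gt0.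
rewrite /average !big_split/= sumr_const -!mulr_sumr !mulrDr -[a *+ _]mulr_natl.
by rewrite mulKf// !(mulrCA #|V|%:R^-1).
Qed.

(** The full-sample fit is compared with the oracle at the selected radius, whose
    risk is at most that of each cross-validation fit at that radius, hence at
    most the cross-validation risk at [that] up to error. That risk is at most
    the one at [t], which the lasso property of the training fits bounds by the
    risk of the oracle at [t]. *)
Lemma cv_excess_risk_le (R : realType) (p n : nat) (mu : probability (obs R p)
    R)
    (V : {set {set 'I_n}}) (z : 'I_n -> obs R p)
    (bhat : {set 'I_n} -> R -> 'rV[R]_p) (bstar : R -> 'rV[R]_p)
    (that tmax t : R) :
  (forall j k, mu.-integrable setT (fun z => (tnth z j * tnth z k)%:E)) ->
  V != finset.set0 ->
  (forall S s, 0 <= s -> is_argmin (empirical_risk S z) (l1_ball s) (bhat S s))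
      ->
  (forall s, 0 <= s -> is_argmin (risk mu) (l1_ball s) (bstar s)) ->
  is_argmin (cv_risk V z bhat) `[0, tmax] that ->
  0 <= t -> t <= tmax ->
  fine (risk mu (bhat finset.setT that)) <= fine (risk mu (bstar t)) +
    2 * risk_error mu z tmax finset.setT + 2 * average V (risk_error mu z tmax)
    + 2 * average V (fun v => risk_error mu z tmax (~: v)%SET).
Proof.
move=> int V0 hbhat hbstar [that_in that_min] t0 ttmax.
move: that_in; rewrite /= in_itv/= => /andP[that0 thatmax].
set err := risk_error mu z tmax.
have [bst bstmin] := hbstar _ that0.
have [bt btmin] := hbstar _ t0.
have rfin b : risk mu b \is a fin_num by rewrite risk_secondE.
have h1 := lasso_risk_le int that0 thatmax (hbhat finset.setT that that0) bst.
have h2 := that_min t; rewrite /= in_itv/= t0 ttmax in h2; have {}h2 := h2 isT.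
have h3 : fine (risk mu (bstar that)) + (- 1) * average V err + 0 * average V
    err
    <= cv_risk V z bhat that.
  rewrite -average_affine//; apply: average_le => v _.
  have [bv _] := hbhat (~: v)%SET _ that0.
  have := empirical_risk_error v z int that0 thatmax bv.
  have : fine (risk mu (bstar that)) <= fine (risk mu (bhat (~: v)%SET that)).
    by rewrite fine_le//; exact: bstmin.
  rewrite /err ler_norml; lra.
have h4 : cv_risk V z bhat t <= fine (risk mu (bstar t)) + 1 * average V err
    + 2 * average V (fun v => err (~: v)%SET).
  rewrite -average_affine//; apply: average_le => v _.
  have [bv _] := hbhat (~: v)%SET _ t0.
  have := empirical_risk_error v z int t0 ttmax bv.
  have := lasso_risk_le int t0 ttmax (hbhat (~: v)%SET t t0) bt.
  rewrite /err ler_norml; lra.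
move: h1; rewrite -/err; lra.
Qed.

Lemma average_cst (R : realType) (n : nat) (V : {set {set 'I_n}}) (a : R) :
  V != finset.set0 -> average V (fun=> a) = a.
Proof.
move=> V0; rewrite /average sumr_const -[a *+ _]mulr_natl mulKf//.
by rewrite pnatr_eq0 -lt0n card_gt0.
Qed.

(** The three samples whose deviations matter, indexed together: the whole
    sample, the validation set and the training set. *)
Definition data_split {n : nat} (k : 'I_3) (v : {set 'I_n}) : {set 'I_n} :=
  match val k with 0%N => finset.setT | 1%N => v | _ => (~: v)%SET end.

Lemma risk0E (R : realType) (p : nat) (mu : probability (obs R p) R) :
  risk mu 0 = 'E_mu[fun z => (response z ^+ 2)%R]%E.
Proof.
rewrite /risk; congr expectation; apply/funext => z.
by rewrite /sq_loss big1 ?subr0// => j _; rewrite mxE mulr0.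
Qed.

(** In the second alternative the null vector, which lies in every l1 ball and has
    risk [E Y^2], competes with the lasso fit, and the risk of the oracle is
    bounded below by 0. *)
Lemma excess_risk_good (R : realType) (p n : nat) (mu : probability (obs R p) R)
    (V : {set {set 'I_n}}) (z : 'I_n -> obs R p)
    (bhat : {set 'I_n} -> R -> 'rV[R]_p) (bstar : R -> 'rV[R]_p)
    (that tmax t eta x : R) :
  (forall j k, mu.-integrable setT (fun z => (tnth z j * tnth z k)%:E)) ->
  V != finset.set0 ->
  (forall S s, 0 <= s -> is_argmin (empirical_risk S z) (l1_ball s) (bhat S s))
      ->
  (forall s, 0 <= s -> is_argmin (risk mu) (l1_ball s) (bstar s)) ->
  is_argmin (cv_risk V z bhat) `[0, tmax] that ->
  0 <= t -> 0 <= eta ->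
  (forall k, average V (fun v => max_deviation mu [set (ord0, ord0)]%SET
     (data_split k v) z) <= eta) ->
  (forall k, average V (fun v => max_deviation mu finset.setT
     (data_split k v) z) <= x) ->
  (2 * tmax + tmax ^+ 2) * x <= eta ->
  t <= tmax \/ second_moment mu ord0 ord0 <= 2 * eta ->
  (excess_risk mu (bhat finset.setT) bstar that t <= (12 * eta)%:E)%E.
Proof.
move=> int V0 hbhat hbstar argthat t0 eta0 dev0 devx tx tcase.
have [that_in _] := argthat.
move: that_in; rewrite /= in_itv/= => /andP[that0 thatmax].
have tmax0 : 0 <= tmax by exact: le_trans thatmax.
have c0 : 0 <= 2 * tmax + tmax ^+ 2 by rewrite addr_ge0 ?sqr_ge0// mulr_ge0.
have rE b : risk mu b = (fine (risk mu b))%:E.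
  by rewrite fineK// risk_secondE.
have avgerr k : average V (fun v => risk_error mu z tmax (data_split k v))
    <= 2 * eta.
  have := average_affine (fun v => max_deviation mu [set (ord0, ord0)]%SET
      (data_split k v) z)
    (fun v => max_deviation mu finset.setT (data_split k v) z) 0 1
    (2 * tmax + tmax ^+ 2) V0.
  have -> : (fun v => 0 + 1 * max_deviation mu [set (ord0, ord0)]%SET
      (data_split k v) z
      + (2 * tmax + tmax ^+ 2) * max_deviation mu finset.setT (data_split k v)
          z)
      = (fun v => risk_error mu z tmax (data_split k v)).
    by apply/funext => v; rewrite add0r mul1r.
  move=> ->; have := dev0 k; have := ler_wpM2l c0 (devx k); lra.
have e0 := avgerr (@Ordinal 3 0 isT).
have e1 := avgerr (@Ordinal 3 1 isT).
have e2 := avgerr (@Ordinal 3 2 isT).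
move: e0 e1 e2; rewrite /data_split/= average_cst// => e0 e1 e2.
rewrite /excess_risk (rE (bhat _ _)) (rE (bstar _)) -EFinB lee_fin.
case: tcase => [ttmax|m00].
  have := cv_excess_risk_le int V0 hbhat hbstar argthat t0 ttmax.
  have : average V (risk_error mu z tmax) <= 2 * eta by [].
  lra.
have b0 : l1_ball that (0 : 'rV[R]_p).
  by rewrite /l1_ball/= big1// => j _; rewrite mxE normr0.
have := lasso_risk_le int that0 thatmax (hbhat finset.setT that that0) b0.
rewrite risk0E -/(second_moment mu ord0 ord0).
have : 0 <= fine (risk mu (bstar t)).
  by rewrite fine_ge0// /risk expectation_ge0// => u; exact: sqr_ge0.
lra.
Qed.

(** Outside six exceptional sets, two for each kind of sample, [excess_risk_good]
    applies. The condition on [tmax] is only required where the mean of the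
    squared responses is close to its expectation, which holds there because
    that mean is the entry (0, 0) of the empirical second moments. *)
Lemma excess_risk_tail (R : realType) (p n : nat) (mu : probability (obs R p) R)
    (kappa K : R) d (Omega : measurableType d) (P : probability Omega R)
    (Z : 'I_n -> {RV P >-> obs R p}) (V : {set {set 'I_n}})
    (bhat : Omega -> {set 'I_n} -> R -> 'rV[R]_p) (bstar : R -> 'rV[R]_p)
    (that tmax : Omega -> R) (t eta x N s0 s delta : R) :
  let E w := excess_risk mu (bhat w finset.setT) bstar (that w) t in
  let A := 16 * K / kappa ^+ 2 in
  (0 < kappa)%R -> (0 < K)%R -> uniform_mgf mu kappa K -> iid_sample mu Z ->
  V != finset.set0 ->
  (forall w S u, 0 <= u ->
     is_argmin (empirical_risk S (fun i => Z i w)) (l1_ball u) (bhat w S u)) ->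
  (forall u, 0 <= u -> is_argmin (risk mu) (l1_ball u) (bstar u)) ->
  (forall w, is_argmin (cv_risk V (fun i => Z i w) (bhat w))
     `[0, tmax w] (that w)) ->
  measurable_fun setT E ->
  0 <= t -> 0 < N -> N <= n%:R ->
  (forall v, v \in V -> N <= #|v|%:R /\ N <= #|~: v|%:R) ->
  0 < s0 <= kappa / 2 * N -> 0 < s <= kappa / 2 * N ->
  0 <= eta -> 12 * eta <= delta ->
  (forall w, `|n%:R^-1 * \sum_(i < n) response (Z i w) ^+ 2
               - second_moment mu ord0 ord0| <= eta ->
     (2 * tmax w + tmax w ^+ 2) * x <= eta /\
     (t <= tmax w \/ second_moment mu ord0 ord0 <= 2 * eta)) ->
  (P [set w | delta%:E < E w] <=
    (6 * expR (A * s0 ^+ 2 / N - s0 * eta) +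
     6 * p.+1%:R ^+ 2 * expR (A * s ^+ 2 / N - s * x))%:E)%E.
Proof.
move=> E A k0 K0 mgf iid V0 hbhat hbstar argthat mE t0 N0 Nn NV /andP[s00 s0N]
  /andP[sp sN] eta0 etad good.
have NF (k : 'I_3) v : v \in V -> N <= #|data_split k v|%:R.
  move=> /NV[N1 N2]; case: k => -[|[|k]] hk; rewrite /data_split//=.
  by rewrite cardsT card_ord.
have J0 : [set (ord0, ord0)]%SET != finset.set0 :> {set 'I_p.+1 * 'I_p.+1}.
  by apply/set0Pn; exists (ord0, ord0); rewrite finset.in_set1.
have JT : finset.setT != finset.set0 :> {set 'I_p.+1 * 'I_p.+1}.
  by apply/set0Pn; exists (ord0, ord0); rewrite finset.in_setT.
have /choice[B0 B0P] k :=
  averaged_tail eta k0 K0 mgf iid N0 s00 s0N V0 J0 (NF k).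
have /choice[B1 B1P] k :=
  averaged_tail x k0 K0 mgf iid N0 sp sN V0 JT (NF k).
set a0 := expR (A * s0 ^+ 2 / N - s0 * eta).
set a1 := expR (A * s ^+ 2 / N - s * x).
have mB0 k : measurable (B0 k) by have [] := B0P k.
have mB1 k : measurable (B1 k) by have [] := B1P k.
have PB k : (P (B0 k `|` B1 k) <= (2 * a0 + 2 * p.+1%:R ^+ 2 * a1)%:E)%E.
  apply: le_trans (measureU2 _ _ _) _ => //; rewrite EFinD; apply: leeD.
    by have [_ + _] := B0P k; rewrite cards1 mulr1.
  have [_ + _] := B1P k.
  by rewrite cardsT card_prod card_ord natrM -expr2.
pose k_ (i : nat) (h : (i < 3)%N) : 'I_3 := Ordinal h.
pose C k := B0 k `|` B1 k.
have mC k : measurable (C k) by exact: measurableU.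
pose U := C (k_ 0%N isT) `|` C (k_ 1%N isT) `|` C (k_ 2%N isT).
have sub : [set w | (delta%:E < E w)%E] `<=` U.
  move=> w /= dE; apply: contrapT => nU.
  have nC (k : 'I_3) : ~ C k w.
    move=> Ck; apply: nU; case: k Ck => -[|[|[|//]]] hk Ck.
    - by left; left; rewrite (_ : k_ _ _ = Ordinal hk)//; exact/val_inj.
    - by left; right; rewrite (_ : k_ _ _ = Ordinal hk)//; exact/val_inj.
    - by right; rewrite (_ : k_ _ _ = Ordinal hk)//; exact/val_inj.
  have dev0 k : average V (fun v => max_deviation mu [set (ord0, ord0)]%SET
      (data_split k v) (fun i => Z i w)) <= eta.
    by have [_ _] := B0P k; apply => Bk; apply: (nC k); left.
  have devx k : average V (fun v => max_deviation mu finset.setT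
      (data_split k v) (fun i => Z i w)) <= x.
    by have [_ _] := B1P k; apply => Bk; apply: (nC k); right.
  have [] := good w.
    have := dev0 (k_ 0%N isT); rewrite /data_split/= average_cst//.
    apply: le_trans; apply: le_trans (deviation_le_max _ _ _ _); last first.
      by rewrite finset.in_set1.
    rewrite /deviation/= cardsT card_ord.
    rewrite le_eqVlt; apply/orP; left; apply/eqP; congr (`|_ * _ - _|).
    by apply: eq_big => [i|i _]; [rewrite finset.in_setT|rewrite expr2].
  move=> tx tcase.
  have int j k : mu.-integrable setT (fun z => (tnth z j * tnth z k)%:E).
    by have [] := mgf j k.
  have := excess_risk_good int V0 (hbhat w) hbstar (argthat w) t0 eta0 dev0 devx
    tx tcase.
  move=> /(lt_le_trans dE); rewrite lte_fin; lra.
apply: (@le_trans _ _ (P U)).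
  apply: le_measure => //; rewrite inE.
    have -> : [set w | (delta%:E < E w)%E] = setT `&` (E @^-1` `]delta%:E,
        +oo[).
      by apply/seteqP; split => w /=; rewrite in_itv/= andbT; [split|case].
    apply: mE => //; exact: emeasurable_itv.
  by apply: measurableU => //; exact: measurableU.
have -> : 6 * a0 + 6 * p.+1%:R ^+ 2 * a1 = (2 * a0 + 2 * p.+1%:R ^+ 2 * a1)
  + (2 * a0 + 2 * p.+1%:R ^+ 2 * a1) + (2 * a0 + 2 * p.+1%:R ^+ 2 * a1) by ring.
rewrite 2!EFinD; apply: le_trans (measureU2 _ _ _) _ => //.
  exact: measurableU.
apply: leeD; last exact: PB.
apply: le_trans (measureU2 _ _ _) _ => //; apply: leeD; exact: PB.
Qed.

(** * Rates *)

Lemma powR_quarter (R : realType) (a : R) : 0 <= a -> (a `^ 4^-1) ^+ 4 = a.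
Proof. by move=> a0; rewrite -powR_mulrn ?powR_ge0// -powRrM mulVf// powRr1.
    Qed.

(** Real powers of a negative base have value 1, so a power exceeding 1 forces a
    positive base; this is how [b n > 0] follows from the growth of [m]. *)
Lemma powR_gt1_ge1 (R : realType) (a e : R) : 0 < e -> 1 < a `^ e -> 1 <= a.
Proof.
move=> e0; apply: contraTT; rewrite -ltNge -leNgt => a1.
have [a0|a0] := leP 0 a.
  by have := ge0_ler_powR (ltW e0) a0 ler01 (ltW a1); rewrite powR1.
by rewrite /powR lt_eqF// ln0 ?mulr0 ?expR0//; exact: ltW.
Qed.

Lemma log_exponent_split (R : realType) (q : \bar R) : (1 <= q)%E ->
  exists2 e : R, 0 <= e <= 1 & log_exponent q = 4^-1 + e.
Proof.
case: q => [q| |] //= q1; last by exists 0; rewrite ?addr0// lexx ler01.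
rewrite lee_fin in q1; exists (2 * q)^-1 => //.
by rewrite invr_ge0 invf_le1; lra.
Qed.

(** The extra exponent [1 / (2 q)] lies in [[0, 1]], so the corresponding factor
    is at least the minimum of [l] and 1. *)
Lemma powR_log_exponent_ge (R : realType) (q : \bar R) (l : R) : (1 <= q)%E ->
  2^-1 <= l -> l `^ 4^-1 / 2 <= l `^ log_exponent q.
Proof.
move=> /log_exponent_split[e /andP[e0 e1] ->] l2.
have l0 : 0 < l by lra.
rewrite powRD; last by rewrite (gt_eqF l0)/= implybT.
rewrite ler_wpM2l ?powR_ge0//.
have [l1|l1] := leP 1 l.
  by have := ler_powR l1 e0; rewrite powRr0; lra.
apply: (le_trans l2); rewrite /powR gt_eqF// -[leLHS]lnK ?posrE// ler_expR.
have : ln l <= 0 by apply: ln_le0; exact: ltW.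
move=> ln0; have := ler_wnM2r ln0 e1; lra.
Qed.

Lemma powR_dim_exponent_le (R : realType) (q : \bar R) (b : R) : (1 <= q)%E ->
  1 <= b -> b `^ dim_exponent q <= b.
Proof.
move=> q1 b1; have b0 : 0 <= b by lra.
rewrite -[leRHS]powRr1//; apply: ler_powR => //.
case: q q1 => [q| |] //= q1; rewrite lee_fin in q1.
rewrite ler_pdivrMr; lra.
Qed.

Lemma ln_nat_ge_half (R : realType) (p : nat) : (2 <= p)%N ->
  2^-1 <= ln (p%:R : R).
Proof.
move=> p2; have : ln (1 + (- 2^-1) : R) <= - 2^-1 by apply: le_ln1Dx; lra.
rewrite (_ : 1 + _ = 2^-1 :> R); last by field.
rewrite lnV ?posrE// => h; apply: (@le_trans _ _ (ln 2)); first lra.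
by rewrite ler_ln ?posrE ?ltr0n ?ler_nat//; apply: leq_trans p2.
Qed.

Lemma expR_tail (R : realType) (C c delta : R) : 0 < C -> 0 < c -> 0 < delta ->
  exists2 M0 : R, 0 < M0 &
    forall m, M0 <= m -> C * expR (- (c * m)) <= (m ^+ 2 * delta)^-1.
Proof.
move=> C0 c0 d0; exists (6 * C * delta / c ^+ 3).
  by rewrite divr_gt0 ?exprn_gt0// !mulr_gt0.
move=> m mM; have m0 : 0 < m.
  by apply: lt_le_trans mM; rewrite divr_gt0 ?exprn_gt0// !mulr_gt0.
have cm0 : 0 <= c * m by rewrite mulr_ge0// ltW.
have := expR_ge1Dxn 2 cm0; rewrite (_ : 3`!%:R = 6 :> R)// => h.
rewrite expRN ler_pdivrMr ?expR_gt0// mulrC ler_pdivlMr ?mulr_gt0 ?exprn_gt0//.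
move: mM; rewrite ler_pdivrMr ?exprn_gt0// => mM.
have := ler_wpM2l (ltW (exprn_gt0 2 m0)) mM.
rewrite exprMn in h; lra.
Qed.

(** The variables [r], [y] and [u] stand for [b^(1/4)], [(ln p)^(1/4)] and
    [b^(1/4) / (m L)], and [k b] bounds the sizes of all the samples from
    below. *)
Lemma excess_risk_rate (R : realType) (p n : nat) (mu : probability (obs R p) R)
    (kappa K : R) d (Omega : measurableType d) (P : probability Omega R)
    (Z : 'I_n -> {RV P >-> obs R p}) (V : {set {set 'I_n}})
    (bhat : Omega -> {set 'I_n} -> R -> 'rV[R]_p) (bstar : R -> 'rV[R]_p)
    (that tmax : Omega -> R) (t eta H k m r y u delta : R) :
  let E w := excess_risk mu (bhat w finset.setT) bstar (that w) t in
  let sigma := kappa / 2 * k in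
  let C1 := 16 * K / kappa ^+ 2 * sigma ^+ 2 / k in
  let c2 := sigma * eta / (8 * H ^+ 2) in
  let Y2 w := \sum_(i < n) response (Z i w) ^+ 2 in
  (0 < kappa)%R -> (0 < K)%R -> uniform_mgf mu kappa K -> iid_sample mu Z ->
  V != finset.set0 ->
  (forall w S v, 0 <= v ->
     is_argmin (empirical_risk S (fun i => Z i w)) (l1_ball v) (bhat w S v)) ->
  (forall v, 0 <= v -> is_argmin (risk mu) (l1_ball v) (bstar v)) ->
  (forall w, is_argmin (cv_risk V (fun i => Z i w) (bhat w))
     `[0, tmax w] (that w)) ->
  measurable_fun setT E ->
  0 <= t -> 0 < k -> k * r ^+ 4 <= n%:R ->
  (forall v, v \in V -> k * r ^+ 4 <= #|v|%:R /\ k * r ^+ 4 <= #|~: v|%:R) ->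
  0 < eta -> eta <= 1 -> 12 * eta <= delta ->
  1 <= H -> second_moment mu ord0 ord0 + eta <= H ->
  (2 <= p)%N -> 0 < y -> y <= r -> y ^+ 4 = ln p%:R ->
  1 <= m -> m <= r -> 2 * (4 + C1) <= c2 * m ->
  0 < u -> u <= 2 * r / (y * m) -> t <= eta * u ->
  (forall w, tmax w = n%:R^-1 * Y2 w * u) ->
  (P [set w | delta%:E < E w] <=
    (12 * expR C1 * expR (- (c2 / 4 * m)))%:E)%E.
Proof.
move=> E sigma C1 c2 Y2 k0 K0 mgf iid V0 hbhat hbstar argthat mE t0 kk0 kn kV
  eta0 eta1 etad H1 mH p2 y0 yr yl m1 mr c2m u0 ur tu tmaxE.
have r0 : 0 < r by lra.
have r1 : 1 <= r by lra.
have m0 : 0 < m by lra.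
have H0 : 0 < H by lra.
have sig0 : 0 < sigma by rewrite mulr_gt0// divr_gt0.
have C10 : 0 <= C1.
  by rewrite !mulr_ge0 ?invr_ge0 ?sqr_ge0// ltW.
have l2 : 2^-1 <= y ^+ 4 by rewrite yl ln_nat_ge_half.
set x := eta * m * y ^+ 2 / (8 * H ^+ 2 * r ^+ 2).
(* x is the deviation level for which (2 tmax + tmax ^+ 2) * x <= eta as soon
   as the mean squared response is at most H *)
have kNE : kappa / 2 * (k * r ^+ 4) = sigma * r ^+ 4 by rewrite /sigma; ring.
have N0 : 0 < k * r ^+ 4 by rewrite mulr_gt0// exprn_gt0.
have r24 : r ^+ 2 <= r ^+ 4 by apply: ler_weXn2l.
have yr2 : y ^+ 2 <= r ^+ 2 by rewrite ler_pXn2r// nnegrE ltW.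
have := @excess_risk_tail R p n mu kappa K d Omega P Z V bhat bstar that tmax t
  eta x (k * r ^+ 4) (sigma * r ^+ 2) (sigma * (r ^+ 2 * y ^+ 2)) delta
  k0 K0 mgf iid V0 hbhat hbstar argthat mE t0 N0 kn kV.
move=> /(_ _ _ (ltW eta0) etad) tail.
apply: le_trans (tail _ _ _) _ => {tail}.
- by rewrite mulr_gt0 ?exprn_gt0//= kNE ler_wpM2l// ltW.
- rewrite mulr_gt0 ?mulr_gt0 ?exprn_gt0//= kNE ler_wpM2l ?(ltW sig0)//.
  rewrite (_ : r ^+ 4 = r ^+ 2 * r ^+ 2); last by ring.
  by rewrite ler_wpM2l// sqr_ge0.
- move=> w; rewrite ler_norml => /andP[Ylo Yup].
  set Yb := n%:R^-1 * _ in Ylo Yup.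
  have tE : tmax w = Yb * u by exact: tmaxE.
  have Yb0 : 0 <= Yb.
    by rewrite mulr_ge0 ?invr_ge0// sumr_ge0// => i _; exact: sqr_ge0.
  split; last first.
    have [Ye|Ye] := leP eta Yb; last by right; lra.
    by left; rewrite tE; apply: (le_trans tu); rewrite ler_wpM2r// ltW.
  set rho := r / y.
  have rho1 : 1 <= rho by rewrite ler_pdivlMr// mul1r.
  have tm : tmax w <= 2 * H * rho / m.
    rewrite tE; apply: (@le_trans _ _ (H * (2 * r / (y * m)))).
      by apply: ler_pM => //; [exact: ltW|lra].
    by rewrite le_eqVlt; apply/orP; left; apply/eqP; rewrite /rho; field;
        rewrite !gt_eqF.
  have tm0 : 0 <= tmax w by rewrite tE mulr_ge0// ltW.
  have tq : 2 * tmax w + tmax w ^+ 2 <= 8 * H ^+ 2 * rho ^+ 2 / m.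
    set a := 2 * H * rho / m in tm.
    have a0 : 0 <= a by apply: le_trans tm.
    apply: (@le_trans _ _ (2 * a + a ^+ 2)).
      by apply: lerD; [rewrite ler_wpM2l|rewrite ler_pXn2r].
    have Hr1 : 1 <= H * rho by rewrite -[1]mulr1 ler_pM.
    have Hr : H * rho <= (H * rho) ^+ 2 by rewrite expr2 ler_peMl//; lra.
    rewrite ler_pdivlMr// /a.
    have -> : (2 * (2 * H * rho / m) + (2 * H * rho / m) ^+ 2) * m =
        4 * (H * rho) + 4 * (H * rho) ^+ 2 * m^-1 by field; rewrite gt_eqF.
    have mi : m^-1 <= 1 by rewrite invf_le1.
    have := ler_wpM2l (sqr_ge0 (H * rho)) mi.
    rewrite exprMn in Hr *; rewrite mulr1; nra.
  have x0 : 0 <= x.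
    by rewrite /x !mulr_ge0 ?invr_ge0 ?sqr_ge0// ?mulr_ge0 ?sqr_ge0// ltW.
  apply: (le_trans (ler_wpM2r x0 tq)); rewrite le_eqVlt; apply/orP; left.
  by apply/eqP; rewrite /x /rho; field; rewrite !gt_eqF.
have -> : 16 * K / kappa ^+ 2 * (sigma * r ^+ 2) ^+ 2 / (k * r ^+ 4) = C1.
  by rewrite /C1; field; rewrite !gt_eqF.
have -> : 16 * K / kappa ^+ 2 * (sigma * (r ^+ 2 * y ^+ 2)) ^+ 2 / (k * r ^+ 4)
    = C1 * y ^+ 4.
  by rewrite /C1; field; rewrite !gt_eqF.
have -> : sigma * (r ^+ 2 * y ^+ 2) * x = c2 * m * y ^+ 4.
  by rewrite /x /c2; field; rewrite !gt_eqF.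
have c20 : 0 < c2 by rewrite /c2 divr_gt0 ?mulr_gt0// exprn_gt0.
rewrite lee_fin.
have c2s : c2 / 4 <= sigma * eta.
  rewrite /c2 ler_pdivrMr// ler_pdivrMr ?mulr_gt0 ?exprn_gt0//.
  have : 0 < sigma * eta by rewrite mulr_gt0.
  have : 1 <= H ^+ 2 by rewrite exprn_ege1.
  nra.
have e1 : expR (C1 - sigma * r ^+ 2 * eta) <= expR C1 * expR (- (c2 / 4 * m)).
  rewrite expRD ler_wpM2l ?expR_ge0// ler_expR lerN2.
  have rm : m <= r ^+ 2 by rewrite (le_trans mr)// expr2 ler_peMl// ltW.
  apply: (@le_trans _ _ (sigma * eta * m)); first by rewrite ler_wpM2r// ltW.
  by rewrite mulrAC ler_wpM2r ?(ltW eta0)// ler_wpM2l// ltW.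
have pE : p%:R = expR (y ^+ 4).
  by rewrite yl lnK// posrE ltr0n; apply: leq_trans p2.
have p1 : p.+1%:R ^+ 2 <= expR (4 * y ^+ 4).
  rewrite expRM_natl -pE (_ : 4 = 2 * 2)%N// exprM ler_pXn2r ?nnegrE//.
  rewrite -natrX ler_nat -mulnn; apply: leq_trans (leq_mul p2 (leqnn p)).
  by rewrite mul2n -addnn -addn1 leq_add2l ltnW.
have e2 : p.+1%:R ^+ 2 * expR (C1 * y ^+ 4 - c2 * m * y ^+ 4) <=
    expR C1 * expR (- (c2 / 4 * m)).
  apply: (@le_trans _ _ (expR (4 * y ^+ 4 + (C1 * y ^+ 4 - c2 * m * y ^+ 4)))).
    by rewrite [leRHS]expRD ler_wpM2r ?expR_ge0.
  rewrite -expRD ler_expR; nra.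
lra.
Qed.

(** * Asymptotics *)

Lemma l1_ball0 (R : realType) (p : nat) (beta : 'rV[R]_p) :
  l1_ball 0 beta -> beta = 0.
Proof.
rewrite /l1_ball/= => b0; apply/rowP => j; rewrite mxE; apply/eqP.
rewrite -normr_le0; apply: le_trans b0.
by rewrite (bigD1 j)//= lerDl sumr_ge0.
Qed.

Lemma ln_nat_le1 (R : realType) (p : nat) : (p <= 1)%N -> ln (p%:R : R) = 0.
Proof. by case: p => [|[|//]] _; [exact: ln0|exact: ln1]. Qed.

Lemma excess_risk_radius0 (R : realType) (p : nat) (mu : probability (obs R p)
    R)
    (bhat bstar : R -> 'rV[R]_p) (that t : R) :
  (forall j k, mu.-integrable setT (fun z => (tnth z j * tnth z k)%:E)) ->
  l1_ball 0 (bhat that) -> l1_ball 0 (bstar t) ->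
  excess_risk mu bhat bstar that t = 0%E.
Proof.
move=> int /l1_ball0 b1 /l1_ball0 b2; rewrite /excess_risk b1 b2 subee//.
by rewrite risk_secondE.
Qed.

(** The bound of [excess_risk_rate] decays exponentially in [m], so it is
    eventually below [(m ^+ 2 * delta)^-1] whatever its constants are. *)
Lemma excess_risk_prob_eventually_le (R : realType) (q : \bar R) (Cq : R) (p : nat -> nat)
    (mu : forall n, probability (obs R (p n)) R)
    (d : nat -> measure_display) (Omega : forall n, measurableType (d n))
    (P : forall n, probability (Omega n) R)
    (Z : forall n, 'I_n -> {RV (P n) >-> obs R (p n)})
    (V : forall n, {set {set 'I_n}}) (c m t : nat -> R)
    (bhat : forall n, Omega n -> {set 'I_n} -> R -> 'rV[R]_(p n))
    (bstar : forall n, R -> 'rV[R]_(p n))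
    (that : forall n, Omega n -> R) :
  let b : nat -> R := fun n => Num.min (n%:R - c n) (c n) in
  let L := fun n => ln (p n)%:R `^ log_exponent q in
  let a := fun n => n%:R * L n * m n / b n `^ 4^-1 in
  let Y2 := fun n w => \sum_(i < n) response (Z n i w) ^+ 2 in
  let tmax := fun n w => Y2 n w / a n in
  let E := fun n w =>
    excess_risk (mu n) (bhat n w finset.setT) (bstar n) (that n w) (t n) in
  (1 <= q)%E ->
  dist_class q Cq mu ->
  (exists M : R, forall n,
     ('E_(mu n)[fun z => (response z ^+ 2)%R] <= M%:E)%E) ->
  (forall n, iid_sample (mu n) (Z n)) ->
  (forall n, V n != finset.set0) ->
  uniform_asymp V (fun n v => #|v|%:R) c ->
  uniform_asymp V (fun n v => #|~: v|%:R) (fun n => n%:R - c n) ->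
  m n @[n --> \oo] --> +oo ->
  m =o_\oo (fun n => b n `^ 4^-1) ->
  (forall n, 0 <= t n) ->
  t =o_\oo (fun n => b n `^ 4^-1 / (m n * L n)) ->
  (fun n => (p n)%:R : R) =o_\oo (fun n => expR (b n `^ dim_exponent q)) ->
  (forall n w (S : {set 'I_n}) (s : R), 0 <= s ->
     is_argmin (empirical_risk S (fun i => Z n i w)) (l1_ball s)
       (bhat n w S s)) ->
  (forall n (s : R), 0 <= s ->
     is_argmin (risk (mu n)) (l1_ball s) (bstar n s)) ->
  (\forall n \near \oo, forall w,
     is_argmin (cv_risk (V n) (fun i => Z n i w) (bhat n w))
       `[0, tmax n w] (that n w)) ->
  (forall n, measurable_fun setT (E n)) ->
  forall delta : R, 0 < delta ->
    \forall n \near \oo,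
       (P n [set w | (delta%:E < E n w)%E] <= ((m n ^+ 2 * delta)^-1)%:E)%E.
Proof.
move=> b L a Y2 tmax E q1 hmu [M EY2] iid V0 [[k1 k1'] [/= k10 _ asym1]]
  [[k2 k2'] [/= k20 _ asym2]] minf /eqoP mo t0 /eqoP to /eqoP po hbhat hbstar
  argthat mE delta d0.
have [kappa [K [kap0 K0 mgf]]] := dist_class_mgf q1 hmu.
have int n (j k : 'I_(p n).+1) :
    (mu n).-integrable setT (fun z => (tnth z j * tnth z k)%:E).
  by have [] := mgf n j k.
(* excess_risk_good loses a factor 12 *)
pose eta : R := Num.min 1 (delta / 12).
have eta0 : 0 < eta by rewrite lt_min ltr01 divr_gt0.
have eta1 : eta <= 1 by rewrite ge_min lexx.
have etad : 12 * eta <= delta.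
  by rewrite mulrC -ler_pdivlMr// ge_min lexx orbT.
pose H : R := `|M| + 1.
have H1 : 1 <= H by rewrite lerDr.
(* k <= 1 makes k * b n a lower bound for the size of the full sample too *)
pose k : R := Num.min 1 (Num.min k1 k2).
have k0 : 0 < k by rewrite !lt_min ltr01 k10.
have kle1 : k <= 1 by rewrite ge_min lexx.
have kk1 : k <= k1 by rewrite !ge_min lexx orbT.
have kk2 : k <= k2 by rewrite !ge_min lexx !orbT.
have mH n : second_moment (mu n) ord0 ord0 + eta <= H.
  apply: lerD => //; apply: le_trans (ler_norm M).
  rewrite -lee_fin; apply: le_trans (EY2 n).
  by rewrite -risk0E /second_moment -[X in fine X]risk0E fineK// risk_secondE.
pose sigma := kappa / 2 * k.
pose C1 := 16 * K / kappa ^+ 2 * sigma ^+ 2 / k.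
pose c2 := sigma * eta / (8 * H ^+ 2).
have sig0 : 0 < sigma by rewrite mulr_gt0// divr_gt0.
have c20 : 0 < c2.
  apply: divr_gt0; first exact: mulr_gt0.
  by rewrite mulr_gt0// exprn_gt0//; apply: lt_le_trans H1.
have [M0 M00 exptail] : exists2 M0 : R, 0 < M0 & forall m, M0 <= m ->
    12 * expR C1 * expR (- (c2 / 4 * m)) <= (m ^+ 2 * delta)^-1.
  apply: expR_tail => //; last by rewrite divr_gt0.
  by rewrite mulr_gt0// expR_gt0.
move/cvgryPge : minf => minf.
near=> n.
have m2 : 2 <= m n by near: n; exact: minf.
have mM0 : M0 <= m n by near: n; exact: minf.
have mC : 2 * (4 + C1) / c2 <= m n by near: n; exact: minf.
have m0 : 0 < m n by apply: lt_le_trans m2.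
have moN : `|m n| <= 1 * `|b n `^ 4^-1| by near: n; exact: (mo _ ltr01).
have toN : `|t n| <= eta * `|b n `^ 4^-1 / (m n * L n)|.
  by near: n; exact: (to _ eta0).
set r := b n `^ 4^-1 in moN toN.
have mr : m n <= r.
  move: moN; by rewrite mul1r !ger0_norm// ?powR_ge0// ltW.
have r1 : 1 < r by apply: lt_le_trans mr; apply: lt_le_trans m2; rewrite ltr1n.
have r0 : 0 < r by exact: lt_trans r1.
have b1 : 1 <= b n by apply: (@powR_gt1_ge1 _ _ 4^-1).
have b0 : 0 < b n by exact: lt_le_trans b1.
have rb : r ^+ 4 = b n by rewrite powR_quarter// ltW.
have bn1 : b n <= n%:R - c n by rewrite /b ge_min lexx.
have bn2 : b n <= c n by rewrite /b ge_min lexx orbT.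
have c0 : 0 <= c n by apply: le_trans bn2; exact: ltW.
have nb : b n <= n%:R by apply: (le_trans bn1); rewrite gerBl.
have n0 : (0 : R) < n%:R by exact: lt_le_trans nb.
have tle : t n <= eta * (r / (m n * L n)).
  have rmL : 0 <= r / (m n * L n).
    by rewrite divr_ge0 ?mulr_ge0 ?powR_ge0// ltW.
  by move: toN; rewrite !ger0_norm.
have arg : forall w, is_argmin (cv_risk (V n) (fun i => Z n i w) (bhat n w))
    `[0, tmax n w] (that n w) by near: n; exact: argthat.
have kV v : v \in V n -> k * r ^+ 4 <= #|v|%:R /\ k * r ^+ 4 <= #|~: v|%:R.
  have h1 : forall v, v \in V n -> k1 * c n <= #|v|%:R /\ #|v|%:R <= k1' * c n.
    by near: n; exact: asym1.
  have h2 : forall v, v \in V n -> k2 * (n%:R - c n) <= #|~: v|%:R /\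
      #|~: v|%:R <= k2' * (n%:R - c n).
    by near: n; exact: asym2.
  move=> vV; rewrite rb; split.
    by apply: le_trans (h1 v vV).1; apply: ler_pM => //; exact: ltW.
  by apply: le_trans (h2 v vV).1; apply: ler_pM => //; exact: ltW.
(* for p <= 1 both radii are 0 since the logarithm is; otherwise ln p >= 1/2 *)
have [p1|p2] := leqP (p n) 1.
  have L0 : L n = 0.
    rewrite /L ln_nat_le1// powR0//.
    have [e /andP[e0 _] ->] := log_exponent_split q1.
    by rewrite gt_eqF// ltr_wpDr.
  rewrite (_ : [set w | _] = set0) ?measure0.
    by rewrite lee_fin invr_ge0 mulr_ge0 ?sqr_ge0// ltW.
  apply/seteqP; split => w //=; apply/negP; rewrite -leNgt.
  have tn0 : t n = 0.
    by apply/eqP; rewrite eq_le t0 andbT; move: tle; rewrite L0 mulr0 invr0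
        !mulr0.
  have th0 : that n w = 0.
    have [+ _] := arg w; rewrite /tmax /a L0 mulr0 !mul0r invr0 mulr0 /=
        in_itv/=.
    by move=> h; apply/eqP; rewrite eq_le andbC.
  rewrite /E excess_risk_radius0//; first by rewrite lee_fin ltW.
  - by rewrite th0; have [] := hbhat n w finset.setT 0 (lexx 0).
  - by rewrite tn0; have [] := hbstar n 0 (lexx 0).
have l2 : 2^-1 <= ln (p n)%:R :> R by exact: ln_nat_ge_half.
have l0 : 0 < ln (p n)%:R :> R by apply: lt_le_trans l2.
have p0 : (0 : R) < (p n)%:R by rewrite ltr0n; apply: leq_trans p2.
have lb : ln (p n)%:R <= b n.
  have : `|(p n)%:R| <= 1 * `|expR (b n `^ dim_exponent q)| by near: n; exact:
      (po _ ltr01).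
  rewrite mul1r !ger0_norm ?expR_ge0// => h.
  apply: le_trans (powR_dim_exponent_le q1 b1).
  by rewrite -ler_expR lnK.
pose y := ln (p n)%:R `^ 4^-1 : R.
have y0 : 0 < y by rewrite powR_gt0.
have yr : y <= r by apply: ge0_ler_powR; rewrite ?nnegrE// ltW.
have yl : y ^+ 4 = ln (p n)%:R by rewrite powR_quarter// ltW.
have yL : y / 2 <= L n by exact: powR_log_exponent_ge.
have L0 : 0 < L n by apply: lt_le_trans yL; rewrite divr_gt0.
have u0 : 0 < r / (m n * L n) by rewrite divr_gt0// mulr_gt0.
have ule : r / (m n * L n) <= 2 * r / (y * m n).
  rewrite ler_pdivrMr ?mulr_gt0// mulrAC ler_pdivlMr ?mulr_gt0//.
  rewrite [leRHS](_ : _ = r * m n * (L n * 2)); last by ring.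
  rewrite [leLHS](_ : _ = r * m n * y); last by ring.
  by rewrite ler_wpM2l ?mulr_ge0 ?(ltW r0) ?(ltW m0)// -ler_pdivrMr.
apply: le_trans (@excess_risk_rate R (p n) n (mu n) kappa K (d n) (Omega n) (P
    n)
  (Z n) (V n) (bhat n) (bstar n) (that n) (tmax n) (t n) eta H k (m n) r y
  (r / (m n * L n)) delta kap0 K0 (mgf n) (iid n) (V0 n) (hbhat n) (hbstar n)
  arg (mE n) (t0 n) k0 _ kV eta0 eta1 etad H1 (mH n) p2 y0 yr yl _ mr _ u0 ule
  tle _) _.
- rewrite rb; apply: (@le_trans _ _ (1 * b n)); last by rewrite mul1r.
  by rewrite ler_wpM2r// ltW.
- by apply: le_trans m2; rewrite ler1n.
- by rewrite [leRHS]mulrC -ler_pdivrMr.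
- move=> w; rewrite /tmax /a -/(Y2 n w) -/r; field.
  by rewrite !gt_eqF.
- by rewrite lee_fin; exact: exptail.
Unshelve. all: by end_near.
Qed.

Theorem corollary1 (R : realType) (q : \bar R) (Cq : R) (p : nat -> nat)
    (mu : forall n, probability (obs R (p n)) R)
    (d : nat -> measure_display) (Omega : forall n, measurableType (d n))
    (P : forall n, probability (Omega n) R)
    (Z : forall n, 'I_n -> {RV (P n) >-> obs R (p n)})
    (V : forall n, {set {set 'I_n}}) (c m t : nat -> R)
    (bhat : forall n, Omega n -> {set 'I_n} -> R -> 'rV[R]_(p n))
    (bstar : forall n, R -> 'rV[R]_(p n))
    (that : forall n, Omega n -> R) :
  let b : nat -> R := fun n => Num.min (n%:R - c n) (c n) in
  let L := fun n => ln (p n)%:R `^ log_exponent q in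
  let a := fun n => n%:R * L n * m n / b n `^ 4^-1 in
  let Y2 := fun n w => \sum_(i < n) response (Z n i w) ^+ 2 in
  let tmax := fun n w => Y2 n w / a n in
  let E := fun n w =>
    excess_risk (mu n) (bhat n w finset.setT) (bstar n) (that n w) (t n) in
  (1 <= q)%E ->
  dist_class q Cq mu ->
  (exists M : R, forall n,
     ('E_(mu n)[fun z => (response z ^+ 2)%R] <= M%:E)%E) ->
  (forall n, regression_model (mu n)) ->
  (forall n, iid_sample (mu n) (Z n)) ->
  (forall n, V n != finset.set0) ->
  uniform_asymp V (fun n v => #|v|%:R) c ->
  uniform_asymp V (fun n v => #|~: v|%:R) (fun n => n%:R - c n) ->
  m n @[n --> \oo] --> +oo ->
  m =o_\oo (fun n => b n `^ 4^-1) ->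
  (forall n, 0 <= t n) ->
  t =o_\oo (fun n => b n `^ 4^-1 / (m n * L n)) ->
  (fun n => (p n)%:R : R) =o_\oo (fun n => expR (b n `^ dim_exponent q)) ->
  (forall n w (S : {set 'I_n}) (s : R), 0 <= s ->
     is_argmin (empirical_risk S (fun i => Z n i w)) (l1_ball s)
       (bhat n w S s)) ->
  (forall n (s : R), 0 <= s ->
     is_argmin (risk (mu n)) (l1_ball s) (bstar n s)) ->
  (\forall n \near \oo, forall w,
     is_argmin (cv_risk (V n) (fun i => Z n i w) (bhat n w))
       `[0, tmax n w] (that n w)) ->
  (forall n, measurable_fun setT (E n)) ->
  forall delta : R, 0 < delta ->
    (\forall n \near \oo,
       (P n [set w | (delta%:E < E n w)%E] <=
        (((m n) ^+ 2 * delta)^-1 * (1 + Num.sqrt (b n / n%:R))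
         + 2 * expR (- (n%:R / (8 * expR 1 ^+ 2))))%:E)%E)
    /\ P n [set w | (delta%:E < E n w)%E] @[n --> \oo] --> 0%E.
Proof.
move=> b L a Y2 tmax E q1 hmu EY2 _ iid V0 asym1 asym2 minf mo t0 to po hbhat
  hbstar argthat mE delta d0.
have tail := excess_risk_prob_eventually_le q1 hmu EY2 iid V0 asym1 asym2 minf
  mo t0 to po hbhat hbstar argthat mE d0.
split.
  apply: filterS tail => n /le_trans; apply; rewrite lee_fin.
  apply: (@le_trans _ _ ((m n ^+ 2 * delta)^-1 * (1 + Num.sqrt (b n / n%:R)))).
    rewrite ler_peMr ?lerDl ?sqrtr_ge0//.
    by rewrite invr_ge0 mulr_ge0 ?sqr_ge0// ltW.
  by rewrite lerDl mulr_ge0// expR_ge0.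
have minv : (m n)^-1 @[n --> \oo] --> 0.
  apply/gtr0_cvgV0 => //.
  by move/cvgryPge : (minf) => /(_ 1); apply: filterS => n; exact: lt_le_trans.
apply: (@squeeze_cvge _ _ _ _ (cst 0%E) _ (fun n => ((m n)^-1)%:E)).
- have /cvgryPge minf' := minf.
  (* once m delta >= 1, the bound 1 / (m^2 delta) is below 1 / m *)
  near=> n; rewrite measure_ge0/=.
  have m1 : 1 <= m n by near: n; exact: minf'.
  have md : delta^-1 <= m n by near: n; exact: minf'.
  have m0 : 0 < m n by lra.
  have /le_trans -> // : (P n [set w | (delta%:E < E n w)%E] <=
      ((m n ^+ 2 * delta)^-1)%:E)%E by near: n; exact: tail.
  rewrite lee_fin lef_pV2 ?posrE// ?mulr_gt0 ?exprn_gt0//.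
  rewrite expr2 -mulrA ler_peMr ?(ltW m0)//.
  by rewrite -ler_pdivrMr// div1r.
- exact: cvg_cst.
- by apply: cvg_EFin => //; exact: nearW.
Unshelve. all: by end_near.
Qed.
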